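(* Let $N=\{1,\dots,n\}$, let $g:\mathbb{R}_+^n\to\mathbb{R}_+$ be a symmetric, monotone non-decreasing submodular value function satisfying the BSP property, let $X_1,\dots,X_n$ be independent nonnegative random variables with distributions $F_1,\dots,F_n$, let $u(S)=\mathbb{E}[g(\mathcal{X}_S(X_1,\dots,X_n))]$, and let $1\le k\le n$. Then there exists a set function $v$, defined on subsets of $N$ of size at most $k$, whose value $v(S)$ can be computed in polynomial time using only the replication test scores $(a_i^r)_{i\in N,\,1\le r\le k}$, such that for every $S\subseteq N$ with $|S|\le k$, $$\frac{1}{2(\log(k)+1)}\,v(S)\ \le\ u(S)\ \le\ 6\,v(S).$$
   Context: A function $g:\mathbb{R}_+^n\to\mathbb{R}_+$ is a submodular value function if $g(x\vee y)+g(x\wedge y)\le g(x)+g(y)$ for all $x,y$ (componentwise max/min); symmetric if invariant under permutations of coordinates. For $S\subseteq N$, $\mathcal{X}_S(x)$ keeps coordinates $x_i$, $i\in S$, and sets the others to $0$. Replication test score: $a_i^r=\mathbb{E}[g(X_i^{(1)},\dots,X_i^{(r)},0,\dots,0)]$ with $X_i^{(1)},\dots,X_i^{(r)}$ independent with distribution $F_i$. BSP property: for all integers $1<l\le n$ and all $(x_1,\dots,x_l)\in\mathbb{R}_+^l$, $g(g^{-1}(g(x_1,\dots,x_{l-1},0,\dots,0)),x_l,0,\dots,0)\le g(x_1,\dots,x_l,0,\dots,0)$, where $g^{-1}(x)=\max\{y\in\mathbb{R}_+: g(y,0,\dots,0)\le x\}$. Expectations are assumed finite.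
   Formalization: Computability of v(S) from the test scores is claimed for all S with |S| ≤ k except S = ∅ when g(0) ≠ 0, since then u(∅) = g(0) is not determined by the scores even up to a factor; the two inequalities are still shown for every S. *)

(* Defs.v *)
From HB Require Import structures.
From mathcomp Require Import all_boot all_order all_fingroup all_algebra.
From mathcomp Require Import all_classical all_reals all_analysis.

Set Implicit Arguments.
Unset Strict Implicit.
Unset Printing Implicit Defensive.

Import Order.TTheory GRing.Theory Num.Theory.
Import numFieldNormedType.Exports.

Local Open Scope classical_set_scope.
Local Open Scope ring_scope.

(** Value functions. A function R_+^n -> R_+ is a total function on
    [n.-tuple R] about which only the values on the orthant matter. *)
Section ValueFunctions.
Variables (R : realType) (n : nat).
Implicit Types (g : n.-tuple R -> R) (x y : n.-tuple R).

Definition orthant : set (n.-tuple R) :=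
  [set x | forall i, 0 <= tnth x i].

Definition nonneg_valued g := forall x, orthant x -> 0 <= g x.

Definition vjoin x y : n.-tuple R := [tuple Num.max (tnth x i) (tnth y i) | i < n].
Definition vmeet x y : n.-tuple R := [tuple Num.min (tnth x i) (tnth y i) | i < n].

Definition submodular g := forall x y, orthant x -> orthant y ->
  g (vjoin x y) + g (vmeet x y) <= g x + g y.

Definition symmetric_fun g := forall (s : {perm 'I_n}) x, orthant x ->
  g [tuple tnth x (s i) | i < n] = g x.

Definition nondecreasing_value g := forall x y, orthant x -> orthant y ->
  (forall i, tnth x i <= tnth y i) -> g x <= g y.

(** [pad s] is (s_1, ..., s_l, 0, ..., 0). *)
Definition pad (s : seq R) : n.-tuple R := [tuple nth 0 s i | i < n].

(** [is_ginv g w y] : y = max {y in R_+ : g(y, 0, ..., 0) <= w}. It is a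
    relation because the maximum need not exist for an arbitrary g. *)
Definition is_ginv g (w y : R) :=
  [/\ 0 <= y, g (pad [:: y]) <= w &
      forall z, 0 <= z -> g (pad [:: z]) <= w -> z <= y].

(** The inverse has to be defined at the points where the inequality uses it. *)
Definition BSP g := forall (l : nat) (x : l.-tuple R),
  (1 < l <= n)%N -> (forall i, 0 <= tnth x i) ->
  exists2 y, is_ginv g (g (pad (take l.-1 x))) y &
             g (pad [:: y; nth 0 x l.-1]) <= g (pad x).

(** X_S(x) *)
Definition keep (S : {set 'I_n}) x : n.-tuple R :=
  [tuple if i \in S then tnth x i else 0 | i < n].

End ValueFunctions.

Section Probability.
Variable R : realType.

Definition mutually_independent (d : measure_display) (T : measurableType d)
    (P : probability T R) (I : finType) (X : I -> {RV P >-> R}) :=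
  forall (J : {set I}) (B : I -> set R), (forall i, measurable (B i)) ->
    P (\bigcap_(i in [set j | j \in J]) (X i @^-1` B i)) =
    (\prod_(i in J) P (X i @^-1` B i))%E.

Definition same_distribution (d d' : measure_display)
    (T : measurableType d) (T' : measurableType d')
    (P : probability T R) (Q : probability T' R)
    (X : {RV P >-> R}) (Y : {RV Q >-> R}) :=
  forall B, measurable B -> distribution P X B = distribution Q Y B.

Definition utility (d : measure_display) (T : measurableType d)
    (P : probability T R) (n : nat) (g : n.-tuple R -> R)
    (X : 'I_n -> {RV P >-> R}) (S : {set 'I_n}) : \bar R :=
  'E_P[fun w => g (keep S [tuple X i w | i < n])].

(** Y lists n copies of one random variable; a^r is the expected value of g on
    the first r of them. *)
Definition replication_score (d : measure_display) (T : measurableType d)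
    (Q : probability T R) (n : nat) (g : n.-tuple R -> R)
    (Y : 'I_n -> {RV Q >-> R}) (r : nat) : \bar R :=
  'E_Q[fun w => g [tuple if (j < r)%N then Y j w else 0 | j < n]].

End Probability.

(** Real RAM. A program has a memory of naturals and a memory of reals, both
    with indirect addressing. Exact real arithmetic, comparison of reals, and
    addition and truncated subtraction of naturals have unit cost. There is no
    multiplication of naturals, no rounding of reals, and the only real
    constants are 0 and 1. The scores can only be accessed by [RScore]. *)
Inductive instr : Type :=
| NConst (a c : nat)    (* N[a] := c *)
| NAdd (a b c : nat)    (* N[a] := N[b] + N[c] *)
| NSub (a b c : nat)    (* N[a] := N[b] - N[c] *)
| NLoad (a b : nat)     (* N[a] := N[N[b]] *)
| NStore (a b : nat)    (* N[N[a]] := N[b] *)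
| RZero (a : nat)       (* R[a] := 0 *)
| ROne (a : nat)        (* R[a] := 1 *)
| RAdd (a b c : nat)    (* R[a] := R[b] + R[c] *)
| RSub (a b c : nat)    (* R[a] := R[b] - R[c] *)
| RMul (a b c : nat)    (* R[a] := R[b] * R[c] *)
| RDiv (a b c : nat)    (* R[a] := R[b] / R[c] *)
| RLoad (a b : nat)     (* R[a] := R[N[b]] *)
| RStore (a b : nat)    (* R[N[a]] := R[b] *)
| RScore (a i r : nat). (* R[a] := score of item N[i] for N[r] replications *)

Inductive program : Type :=
| Skip
| Instr (i : instr)
| Seq (p q : program)
| IfN (a : nat) (p q : program)    (* if N[a] != 0 *)
| IfR (a b : nat) (p q : program)  (* if R[a] <= R[b] *)
| While (a : nat) (p : program).   (* while N[a] != 0 *)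

Section RealRAM.
Variable R : realType.

Record state := State { nmem : nat -> nat; rmem : nat -> R }.

Definition upd (A : Type) (f : nat -> A) (a : nat) (v : A) : nat -> A :=
  fun b => if b == a then v else f b.

Definition setN (s : state) a v := State (upd (nmem s) a v) (rmem s).
Definition setR (s : state) a v := State (nmem s) (upd (rmem s) a v).

Definition exec_instr (score : nat -> nat -> R) (i : instr) (s : state) : state :=
  let N := nmem s in let X := rmem s in
  match i with
  | NConst a c => setN s a c
  | NAdd a b c => setN s a (N b + N c)%N
  | NSub a b c => setN s a (N b - N c)%N
  | NLoad a b => setN s a (N (N b))
  | NStore a b => setN s (N a) (N b)
  | RZero a => setR s a 0
  | ROne a => setR s a 1
  | RAdd a b c => setR s a (X b + X c)
  | RSub a b c => setR s a (X b - X c)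
  | RMul a b c => setR s a (X b * X c)
  | RDiv a b c => setR s a (X b / X c)
  | RLoad a b => setR s a (X (N b))
  | RStore a b => setR s (N a) (X b)
  | RScore a i r => setR s a (score (N i) (N r))
  end.

(** [exec score p s t s'] : started in s, p halts in s' after t steps. *)
Inductive exec (score : nat -> nat -> R) :
    program -> state -> nat -> state -> Prop :=
| exec_skip s : exec score Skip s 0 s
| exec_instr1 i s : exec score (Instr i) s 1 (exec_instr score i s)
| exec_seq p q s1 s2 s3 t u : exec score p s1 t s2 -> exec score q s2 u s3 ->
    exec score (Seq p q) s1 (t + u) s3
| exec_ifN a p q s s' t :
    exec score (if nmem s a != 0%N then p else q) s t s' ->
    exec score (IfN a p q) s t.+1 s'
| exec_ifR a b p q s s' t :
    exec score (if rmem s a <= rmem s b then p else q) s t s' ->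
    exec score (IfR a b p q) s t.+1 s'
| exec_while0 a p s : nmem s a = 0%N -> exec score (While a p) s 1 s
| exec_whileS a p s1 s2 s3 t u : nmem s1 a != 0%N ->
    exec score p s1 t s2 -> exec score (While a p) s2 u s3 ->
    exec score (While a p) s1 (t + u).+1 s3.

(** Input: n, k and the characteristic vector of S. *)
Definition input_state (n k : nat) (S : {set 'I_n}) : state :=
  State (fun a => match a with
                  | 0 => n
                  | 1 => k
                  | i.+2 => if insub i is Some j then nat_of_bool (j \in S) else 0%N
                  end)
        (fun=> 0).

(** Only a_i^r with i in N and 1 <= r <= k are visible; the items are numbered
    from 0. *)
Definition score_table (n k : nat) (a : 'I_n -> nat -> R) (i r : nat) : R :=
  if insub i is Some j then if (1 <= r <= k)%N then a j r else 0 else 0.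

(** The result is left in the real cell 0. *)
Definition computes_within (p : program) (t : nat) (n k : nat)
    (a : 'I_n -> nat -> R) (S : {set 'I_n}) (y : R) :=
  exists t' s', [/\ exec (score_table k a) p (input_state k S) t' s',
                    (t' <= t)%N & rmem s' 0%N = y].

End RealRAM.

(* Main.v *)
Require Import Defs.
From HB Require Import structures.
From mathcomp Require Import all_boot all_order all_fingroup all_algebra.
From mathcomp Require Import all_classical all_reals all_analysis.
From mathcomp Require Import measurable_realfun.
From mathcomp Require Import zify lra.

Import Order.TTheory GRing.Theory Num.Theory.
Import numFieldNormedType.Exports.

Local Open Scope classical_set_scope.
Local Open Scope ring_scope.

(** The sketch is v(S) = H_s b with s = |S| and H_s the s-th harmonic number.
    For r = s, ..., 1 let i_r be an item with the smallest score for r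
    replications among the items not chosen before, and let b be the maximum of
    the scores of i_r for r replications.

    Lower bound. Let T be a set of r items, x the vector of their values and y a
    vector of r copies of an item j of T, placed on the same coordinates. Since
    g(y) <= g(x \/ y), submodularity bounds the score of j by u(T) plus the
    marginals of single copies of j over T minus one item. By symmetry and
    diminishing returns, the sum of these bounds over j in T is at most 2 r u(T),
    so the smallest of the r scores is at most 2 u(T). Hence b <= 2 u(S).

    Upper bound. Let y^1, ..., y^s be samples where y^r has r - 1 entries and
    g(y^r) <= c. Let z be the vector whose j-th entry is the maximum over r of
    the j-th largest entry of y^r. Then g(z_j, ..., z_j) <= c with j entries, so
    g(z) <= c H_s, and by submodularity the marginal of a value over z is at
    most its marginal over each y^r. Hence g(x) <= c H_s + sum_r (marginal of x_r
    over y^r) for every x. Take for y^r copies of i_r and c slightly above 2 b. By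
    Markov's inequality half of the samples satisfy g(y^r) <= c, so on average the
    r-th marginal costs at most twice the difference of two consecutive scores of
    i_r, that is, at most 2 b / r. This gives u(S) <= 4 H_s b. *)

Set Implicit Arguments.
Unset Strict Implicit.
Unset Printing Implicit Defensive.

(** * Pointwise inequalities for value functions *)

Definition harmonic_sum {R : realType} (m : nat) : R := \sum_(j < m) j.+1%:R^-1.

Lemma nth_ge0 (R : realType) (s : seq R) j : all (>= 0) s -> 0 <= nth 0 s j.
Proof.
by move=> s0; have [js|?] := ltnP j (size s); [exact: (allP s0 _ (mem_nth 0 js))|rewrite nth_default].
Qed.

Lemma card_lt_set n r : (r <= n)%N -> #|[set i : 'I_n | (i < r)%N]%SET| = r.
Proof.
move=> rn; rewrite -sum1_card -[RHS]card_ord -sum1_card.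
rewrite (big_ord_widen_cond n xpredT (fun=> 1)%N rn) /=.
by apply: eq_bigl => i; rewrite inE.
Qed.

Section ValueFunctionTheory.
Context {R : realType} {n : nat} {g : n.-tuple R -> R}.
Hypotheses (g_ge0 : nonneg_valued g) (g_sym : symmetric_fun g)
  (g_nd : nondecreasing_value g) (g_sub : submodular g).

Local Notation G f := (g [tuple f i | i < n]).
Implicit Types (x y f h : 'I_n -> R) (A B : {set 'I_n}).

Definition restrict_coords A x : 'I_n -> R := fun i => if i \in A then x i else 0.

Lemma restrict_coords_ge0 A x : (forall i, 0 <= x i) ->
  forall i, 0 <= restrict_coords A x i.
Proof. by move=> x0 i; rewrite /restrict_coords; case: ifP. Qed.

Lemma orthant_mktuple f : (forall i, 0 <= f i) -> orthant [tuple f i | i < n].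
Proof. by move=> f0 i; rewrite tnth_mktuple. Qed.

Lemma value_ge0 f : (forall i, 0 <= f i) -> 0 <= G f.
Proof. by move=> f0; apply/g_ge0/orthant_mktuple. Qed.

Lemma value_le f h : (forall i, 0 <= f i) -> (forall i, f i <= h i) -> G f <= G h.
Proof.
move=> f0 fh; apply: g_nd => [||i]; [exact: orthant_mktuple| |by rewrite !tnth_mktuple].
by apply: orthant_mktuple => i; apply: le_trans (fh i).
Qed.

Lemma value_ext f h : f =1 h -> G f = G h.
Proof. by move=> fh; congr g; apply: eq_mktuple. Qed.

(** Monotonicity relaxes submodularity: [j] and [m] need only lie below the join and the meet. Every
    later use of diminishing returns goes through this form. *)
Lemma value_exchange (a b j m : 'I_n -> R) :
  (forall i, 0 <= a i) -> (forall i, 0 <= b i) ->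
  (forall i, 0 <= j i <= Num.max (a i) (b i)) ->
  (forall i, 0 <= m i <= Num.min (a i) (b i)) ->
  G j + G m <= G a + G b.
Proof.
move=> a0 b0 hj hm.
have := g_sub (orthant_mktuple a0) (orthant_mktuple b0); apply: le_trans.
by apply: lerD; apply: value_le => i; rewrite ?tnth_mktuple;
  [case/andP: (hj i)..|case/andP: (hm i)|case/andP: (hm i)].
Qed.

Lemma value_permute (s : {perm 'I_n}) f : (forall i, 0 <= f i) ->
  G (fun i => f (s i)) = G f.
Proof.
move=> f0; rewrite -(g_sym s (orthant_mktuple f0)).
by congr g; apply: eq_mktuple => i; rewrite tnth_mktuple.
Qed.

Lemma value_perm_eq f h : (forall i, 0 <= h i) ->
  perm_eq [tuple f i | i < n] [tuple h i | i < n] -> G f = G h.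
Proof.
move=> h0 /tuple_permP[s fh]; rewrite -(value_permute s h0); congr g.
by apply: val_inj; apply: etrans fh _; apply: eq_map => i; rewrite tnth_mktuple.
Qed.

Lemma pad_catE (s : seq R) : (size s <= n)%N -> pad n s = s ++ nseq (n - size s) 0 :> seq R.
Proof.
move=> sn; apply: (@eq_from_nth _ 0) => [|i].
  by rewrite size_tuple size_cat size_nseq subnKC.
rewrite size_tuple => ilt; rewrite -[i]/(val (Ordinal ilt)) -tnth_nth tnth_mktuple /=.
by rewrite nth_cat nth_nseq if_same; case: ltnP => // /(nth_default 0).
Qed.

Lemma value_pad_perm (s s' : seq R) : (size s <= n)%N -> all (>= 0) s' ->
  perm_eq s s' -> g (pad n s) = g (pad n s').
Proof.
move=> sn s0 ss'; apply: value_perm_eq.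
  by move=> i; have [is'|?] := ltnP i (size s'); [exact: (allP s0 _ (mem_nth 0 is'))|rewrite nth_default].
by rewrite -!/(pad n _) !pad_catE -?(perm_size ss')// perm_cat2r.
Qed.

(** Reading the coordinates along [l] and then the zeros outside [A] only permutes the vector, so
    symmetry applies. This passes from sets of items to padded lists. *)
Lemma value_restrict_seq A x (l : seq 'I_n) : (forall i, 0 <= x i) ->
  uniq l -> l =i A -> G (restrict_coords A x) = g (pad n (map x l)).
Proof.
move=> x0 ul lA.
have szl : (size (map x l) <= n)%N.
  by rewrite size_map -[X in (_ <= X)%N]card_ord -(card_uniqP ul) max_card.
apply: value_perm_eq.
  move=> i; have [im|?] := ltnP i (size (map x l)); last by rewrite nth_default.
  by have /mapP[j _ ->] := mem_nth 0 im.
rewrite -!/(pad n _) !pad_catE//=.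
set r := [seq i <- enum 'I_n | i \notin l].
have lr : perm_eq (enum 'I_n) (l ++ r).
  apply: uniq_perm; first exact: enum_uniq.
    rewrite cat_uniq ul filter_uniq ?enum_uniq// andbT /=.
    by apply/hasPn => i; rewrite mem_filter => /andP[].
  by move=> i; rewrite mem_cat mem_enum [in RHS]mem_filter mem_enum andbT orbN.
rewrite (perm_trans (perm_map (restrict_coords A x) lr))// map_cat.
have -> : map (restrict_coords A x) l = map x l.
  by apply/eq_in_map => i il; rewrite /restrict_coords -lA il.
have -> : map (restrict_coords A x) r = nseq (size r) 0.
  rewrite -(size_map (restrict_coords A x)); apply/all_pred1P/allP => _ /mapP[i ir ->].
  by move: ir; rewrite mem_filter /restrict_coords -lA /= => /andP[/negPf->].
rewrite perm_cat2l; have /perm_size := lr.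
by rewrite size_cat size_enum_ord size_map => szn; rewrite [X in (X - _)%N]szn addKn.
Qed.

(** The coordinates are raised one after the other, and by diminishing returns each raise gains at
    most what it would gain over [x] itself. *)
Lemma value_raise_sum x y (s : seq 'I_n) :
  (forall i, 0 <= x i) -> (forall i, 0 <= y i) ->
  G (fun i => if i \in s then Num.max (x i) (y i) else x i) - G x <=
  \sum_(j <- s) (G (fun i => if i == j then Num.max (x i) (y i) else x i) - G x).
Proof.
move=> x0 y0; elim: s => [|j s IH]; first by rewrite big_nil subrr.
rewrite big_cons; apply: le_trans (lerD (lexx _) IH).
suff: G (fun i => if i \in j :: s then Num.max (x i) (y i) else x i) + G x <=
  G (fun i => if i == j then Num.max (x i) (y i) else x i) +
  G (fun i => if i \in s then Num.max (x i) (y i) else x i) by lra.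
have mx i : 0 <= Num.max (x i) (y i) by rewrite le_max x0.
apply: value_exchange => i.
- by case: ifP.
- by case: ifP.
- by rewrite inE; case: (i == j); case: (i \in s); rewrite /= ?mx ?x0 /= le_max lexx ?orbT.
- by rewrite x0 le_min /=; apply/andP; split; case: ifP; rewrite ?le_max ?lexx.
Qed.

(** The coordinates of [A] are added one by one, starting from 0. The gain of [j] at its turn is at
    least its gain over all of [A :\ j], and the gains telescope; the value at 0 left over is
    nonnegative. *)
Lemma value_marginal_sum A x : (forall i, 0 <= x i) ->
  \sum_(j in A) (G (restrict_coords A x) - G (restrict_coords (A :\ j) x)) <=
  G (restrict_coords A x).
Proof.
move=> x0; rewrite -big_enum /=.
suff H (s : seq 'I_n) : uniq s -> {subset s <= A} ->
    \sum_(j <- s) (G (restrict_coords A x) - G (restrict_coords (A :\ j) x)) <=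
    G (restrict_coords [set j in s] x).
  have := H _ (enum_uniq A); rewrite (_ : [set _ in _] = A); last first.
    by apply/setP => i; rewrite inE mem_enum.
  by apply=> i; rewrite mem_enum.
elim: s => [_ _|j s IH /= /andP[js us] sA].
  by rewrite big_nil; apply/value_ge0/restrict_coords_ge0.
have {}IH := IH us (fun i is_ => sA i (mem_behead (s := j :: s) is_)).
have jA : j \in A by apply: sA; rewrite mem_head.
rewrite big_cons; apply: le_trans (lerD (lexx _) IH) _.
suff: G (restrict_coords A x) + G (restrict_coords [set i in s] x) <=
  G (restrict_coords (A :\ j) x) + G (restrict_coords [set i in j :: s] x) by lra.
have r0 := fun B => @restrict_coords_ge0 B x x0.
apply: value_exchange => // i; rewrite r0 /= /restrict_coords !inE.
- rewrite le_max; have [->|ij] := eqVneq i j; first by rewrite jA lexx orbT.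
  by rewrite /= lexx.
- rewrite le_min; have [->|ij] := eqVneq i j; first by rewrite (negPf js) lexx x0.
  have [is_|_] := boolP (i \in s); last by rewrite /=; case: ifP => _; rewrite ?x0 lexx.
  by rewrite /= sA ?lexx// inE is_ orbT.
Qed.

Definition plateau (m : nat) (z : R) : 'I_n -> R := fun i => if (i < m)%N then z else 0.

(** By symmetry the m+1 terms of [value_marginal_sum] are equal for a constant vector. *)
Lemma value_plateau_marginal m z : (m < n)%N -> 0 <= z ->
  m.+1%:R * (G (plateau m.+1 z) - G (plateau m z)) <= G (plateau m.+1 z).
Proof.
move=> mn z0.
have plat k : plateau k z =1 restrict_coords [set i : 'I_n | (i < k)%N]%SET (fun=> z).
  by move=> i; rewrite /plateau /restrict_coords inE.
have card_dep B : G (restrict_coords B (fun=> z)) = g (pad n (nseq #|B| z)).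
  rewrite (@value_restrict_seq _ _ (enum B)) ?enum_uniq//; last by move=> i; rewrite mem_enum.
  by congr (g (pad n _)); rewrite cardE; elim: (enum B) => //= i l ->.
have := value_marginal_sum [set i : 'I_n | (i < m.+1)%N]%SET (fun=> z0).
rewrite (eq_bigr (fun=> G (plateau m.+1 z) - G (plateau m z))) => [|i].
  by rewrite sumr_const card_lt_set// mulr_natl (value_ext (plat m.+1)).
move=> im; rewrite (value_ext (plat m.+1)) (value_ext (plat m)) !card_dep.
congr (_ - g (pad n (nseq _ z))); have := cardsD1 i [set i : 'I_n | (i < m.+1)%N]%SET.
by rewrite im !card_lt_set// 1?ltnW//; lia.
Qed.

(** The profile is built from left to right. The j-th entry, counted from 1, costs at most as much
    as the last step of a plateau of its own height, that is, at most c / j. *)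
Lemma value_nonincreasing_le (c : R) (f : nat -> R) m : (0 < m <= n)%N ->
  (forall j, 0 <= f j) -> (forall i j, (i <= j)%N -> f j <= f i) ->
  (forall j, (j < m)%N -> G (plateau j.+1 (f j)) <= c) ->
  G (fun i : 'I_n => if (i < m)%N then f i else 0) <= c * harmonic_sum m.
Proof.
move=> /andP[m0 mn] f0 fnd fc.
elim: m m0 mn fc => [//|[|m] IH] _ mn fc.
  rewrite /harmonic_sum big_ord_recl big_ord0 addr0 invr1 mulr1.
  apply: le_trans (fc 0%N isT); rewrite le_eqVlt; apply/orP; left; apply/eqP.
  by apply: value_ext => i; rewrite /plateau; case: ltnP => //; rewrite ltnS leqn0 => /eqP->.
have {}IH := IH isT (ltnW mn) (fun j jm => fc j (ltnW jm)).
rewrite /harmonic_sum big_ord_recr /= -/(harmonic_sum m.+1) mulrDr.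
apply: le_trans (lerD IH (lexx _)).
have := value_plateau_marginal mn (f0 m.+1).
have := fc m.+1 (ltnSn _).
set b := G (plateau m.+2 _); set a := G (plateau m.+1 _) => bc ab.
(* The plateau of height [f m.+1] on m+1 coordinates lies below the profile, so the new entry gains
   at most as much over the profile as over the plateau. *)
have : G (fun i : 'I_n => if (i < m.+2)%N then f i else 0) + a <=
       G (fun i : 'I_n => if (i < m.+1)%N then f i else 0) + b.
  apply: value_exchange => i.
  - by case: ifP.
  - by rewrite /plateau; case: ifP.
  - rewrite /plateau le_max; case: (ltngtP i m.+1) => [im|im|im].
    + by rewrite ltnS ltnW// f0 lexx.
    + by rewrite ltnS leqNgt im lexx.
    + by rewrite im ltnSn f0 lexx orbT.
  - rewrite /plateau le_min; case: (ltnP i m.+1) => im; last by case: ifP; rewrite ?lexx ?f0.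
    by rewrite ltnS ltnW// f0 lexx fnd// ltnW.
have m2 : 0 < m.+2%:R :> R by [].
have : b - a <= c * m.+2%:R^-1.
  by rewrite ler_pdivlMr// mulrC (le_trans ab).
move=> ba exch; rewrite -(lerD2r a); apply: le_trans exch _.
by rewrite -addrA lerD2l -lerBlDr.
Qed.

(* The maximum over r of the j-th largest entry of [ys r] is a nonincreasing
   profile that dominates all the [ys r] at once, yet its value is at most
   [c * H_s] because each of its entries, repeated j times, has value at most [c]. *)
Lemma value_le_harmonic_marginals (c : R) (xs : seq R) (ys : nat -> seq R) :
  (0 < size xs <= n)%N -> all (>= 0) xs ->
  (forall r, (r < size xs)%N ->
     [/\ size (ys r) = r, all (>= 0) (ys r) & g (pad n (ys r)) <= c]) ->
  g (pad n xs) <= c * harmonic_sum (size xs) +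
    \sum_(r < size xs) (g (pad n (rcons (ys r) (nth 0 xs r))) - g (pad n (ys r))).
Proof.
set s := size xs => /andP[s0 sn] xs0 hys.
pose z r := sort >=%R (ys r).
have szz r : (r < s)%N -> size (z r) = r by move=> rs; have [sz _ _] := hys r rs; rewrite size_sort.
have z0 r : (r < s)%N -> all (>= 0) (z r) by move=> rs; have [_ y0 _] := hys r rs; rewrite all_sort.
have znd r i j : (r < s)%N -> (i <= j)%N -> nth 0 (z r) j <= nth 0 (z r) i.
  move=> rs ij; have [js|?] := ltnP j (size (z r)); last first.
    by rewrite nth_default// nth_ge0// z0.
  have srt : sorted >=%R (z r) by apply: sort_sorted => a b; exact: le_total.
  have := @sorted_leq_nth _ >=%R _ _ 0 _ srt i j; rewrite !inE; apply => //.
  - by move=> a b d ba db; exact: le_trans db ba.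
  - exact: lexx.
  - exact: leq_ltn_trans ij js.
have zperm r : (r < s)%N -> g (pad n (z r)) = g (pad n (ys r)).
  move=> rs; have [sz y0 _] := hys r rs; apply: value_pad_perm => //.
    by rewrite szz//; apply: leq_trans sn; apply: ltnW.
  by rewrite perm_sort.
pose f j : R := \big[Num.max/0]_(r < s) nth 0 (z r) j.
have f0 j : 0 <= f j by apply: (big_rec (fun v : R => 0 <= v)) => // r v _ v0; rewrite le_max v0 orbT.
have fz r j : (r < s)%N -> nth 0 (z r) j <= f j.
  by move=> rs; apply: (le_bigmax _ (fun r : 'I_s => nth 0 (z r) j) (Ordinal rs)).
have fnd i j : (i <= j)%N -> f j <= f i.
  move=> ij; rewrite /f; apply: bigmax_le => [|r _]; first exact: f0.
  by apply: le_trans (fz _ _ (ltn_ord r)); apply: znd.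
have fc j : (j < s)%N -> G (plateau j.+1 (f j)) <= c.
  move=> js; rewrite /f.
  (* The default 0 of the maximum is covered by the empty sample [ys 0]. For an entry of [z r], the
     entries up to position j are at least as large, so the plateau lies below [z r]. *)
  apply: (big_rec (fun v => G (plateau j.+1 v) <= c)) => [|r v _ vc].
    have [sz y0 yc] := hys 0%N s0; apply: le_trans yc.
    by rewrite (size0nil sz) le_eqVlt; apply/orP; left; apply/eqP/value_ext => i;
      rewrite /plateau nth_nil if_same.
  have [_|_] := leP (nth 0 (z r) j) v; first exact: vc.
  have [_ _ yc] := hys r (ltn_ord r); apply: le_trans yc; rewrite -zperm//.
  apply: value_le => i; rewrite /plateau; case: ifP => // ij; rewrite ?nth_ge0 ?z0//.
  exact: znd.
have := @value_nonincreasing_le c f s; rewrite s0 sn => /(_ isT f0 fnd fc).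
set fs := fun i : 'I_n => _ => gf.
have fs0 i : 0 <= fs i by rewrite /fs; case: ifP.
pose x (i : 'I_n) := nth 0 xs i.
have x0 i : 0 <= x i by apply: nth_ge0.
pose l := [seq widen_ord sn r | r <- enum 'I_s].
have lP i : (i \in l) = (i < s)%N.
  apply/mapP/idP => [[r _ ->]|ilt]; first exact: (ltn_ord r).
  by exists (Ordinal ilt); rewrite ?mem_enum//; apply: val_inj.
have := value_raise_sum l fs0 x0; rewrite big_map big_enum /= => graise.
have gx : g (pad n xs) <= G (fun i => if i \in l then Num.max (fs i) (x i) else fs i).
  apply: value_le => i; first exact: x0.
  rewrite lP; case: ltnP => [_|si]; first by rewrite le_max lexx orbT.
  by rewrite nth_default.
(* Positions count from 0: [z r] fills the coordinates below r and lies under [fs], and the entry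
   appended to it falls exactly on the coordinate r that is raised. *)
suff marg (r : 'I_s) : G (fun i : 'I_n => if i == widen_ord sn r then Num.max (fs i) (x i) else fs i)
     - G fs <= g (pad n (rcons (ys r) (nth 0 xs r))) - g (pad n (ys r)).
  have := ler_sum (index_enum 'I_s) (fun r (_ : true) => marg r).
  by move=> summ; have := le_trans graise summ; lra.
have rs := ltn_ord r; have [sz y0 _] := hys r rs.
rewrite -zperm//.
have -> : g (pad n (rcons (ys r) (nth 0 xs r))) = g (pad n (rcons (z r) (nth 0 xs r))).
  apply: value_pad_perm.
  - by rewrite size_rcons sz (leq_trans rs).
  - by rewrite all_rcons z0// nth_ge0.
  - by rewrite -!cats1 perm_cat2r perm_sym perm_sort.
rewrite lerBlDr addrAC lerBrDr.
rewrite [X in _ <= X]addrC.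
have szr := szz r rs.
apply: value_exchange => // i.
- by apply: nth_ge0; rewrite all_rcons z0// nth_ge0.
- have -> : (i == widen_ord sn r) = (i == r :> nat) by [].
  rewrite nth_rcons szr; case: (eqVneq (i : nat) r) => [ir|_]; last by rewrite fs0 le_max lexx.
  by rewrite {1}ir ltnn (_ : nth 0 xs r = x i) ?lexx ?le_max ?fs0// /x ir.
- rewrite nth_rcons szr nth_ge0 ?z0//= le_min; apply/andP; split.
    rewrite /fs; case: ltnP => [_|si]; first exact: fz.
    by rewrite nth_default// szr (leq_trans _ si)// ltnW.
  case: ltnP => // ri; rewrite nth_default ?szr//; case: ifP => // _; exact: nth_ge0.
Qed.

End ValueFunctionTheory.

(** * Laws of independent coordinates *)

Section RectangleLaws.
Context {R : realType} {n : nat}.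
Implicit Types (D : {set 'I_n}) (nu : 'I_n -> set R -> \bar R).

(** A joint law is recorded through its rectangles over [D] alone, with plain set functions as
    marginals. Two laws are then compared without building an n-fold product measure. *)
Definition has_law (d : measure_display) (T : measurableType d) (P : probability T R)
    D (U : 'I_n -> T -> R) nu :=
  forall C : 'I_n -> set R, (forall i, measurable (C i)) ->
    P [set w | forall i, i \in D -> C i (U i w)] = (\prod_(i in D) nu i (C i))%E.

Lemma has_law_ext (d : measure_display) (T : measurableType d) (P : probability T R)
    D (U : 'I_n -> T -> R) nu nu' :
  (forall i B, i \in D -> measurable B -> nu i B = nu' i B) ->
  has_law P D U nu -> has_law P D U nu'.
Proof. by move=> nn' h C mC; rewrite h//; apply: eq_bigr => i iD; apply: nn'. Qed.

Lemma measurable_bigcap_coords (d : measure_display) (T : measurableType d)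
    D (U : 'I_n -> T -> R) (C : 'I_n -> set R) :
  (forall i, measurable_fun setT (U i)) -> (forall i, measurable (C i)) ->
  measurable [set w | forall i, i \in D -> C i (U i w)].
Proof.
move=> mU mC.
apply: (@fin_bigcap_measurable _ _ _ [set i | i \in D] (fun i => U i @^-1` C i)) => [|i _].
  exact: finite_finset.
by rewrite -[X in measurable X]setTI; apply: mU.
Qed.

Lemma has_law_permute (d : measure_display) (T : measurableType d) (P : probability T R)
    (s : {perm 'I_n}) D (U : 'I_n -> T -> R) nu :
  has_law P (s @: D) U nu -> has_law P D (fun i => U (s i)) (fun i => nu (s i)).
Proof.
move=> h C mC; have := h (fun j => C ((s^-1)%g j)) (fun j => mC _).
rewrite (big_imset _ (in2W (@perm_inj _ s))) /=.
under eq_bigr do rewrite permK.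
move=> <-; congr (P _); apply/seteqP; split => w /= hw i.
  by move=> /imsetP[j jD ->]; rewrite permK; apply: hw.
by move=> iD; have := hw (s i) (imset_f _ iD); rewrite permK.
Qed.

Definition mix_coords (T1 T2 : Type) D (U : 'I_n -> T1 -> R) (V : 'I_n -> T2 -> R)
    (i : 'I_n) (w : T1 * T2) : R :=
  if i \in D then U i w.1 else V i w.2.

Lemma measurable_mix_coords (d1 d2 : measure_display)
    (T1 : measurableType d1) (T2 : measurableType d2) D
    (U : 'I_n -> T1 -> R) (V : 'I_n -> T2 -> R) :
  (forall i, measurable_fun setT (U i)) -> (forall i, measurable_fun setT (V i)) ->
  forall i, measurable_fun setT (mix_coords D U V i).
Proof.
move=> mU mV i; rewrite /mix_coords; case: (i \in D).
- exact: measurableT_comp (mU i) measurable_fst.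
- exact: measurableT_comp (mV i) measurable_snd.
Qed.

(** A rectangle for the mixed vector is the product of a rectangle in each factor, so its
    probability splits. *)
Lemma has_law_mix (d1 d2 : measure_display)
    (T1 : measurableType d1) (T2 : measurableType d2)
    (P : probability T1 R) (Q : probability T2 R) D1 D
    (U : 'I_n -> T1 -> R) (V : 'I_n -> T2 -> R) nu nu' :
  (forall i, measurable_fun setT (U i)) -> (forall i, measurable_fun setT (V i)) ->
  has_law P (D :&: D1) U nu -> has_law Q (D :\: D1) V nu' ->
  has_law (P \x Q)%E D (mix_coords D1 U V) (fun i => if i \in D1 then nu i else nu' i).
Proof.
move=> mU mV hU hV C mC.
rewrite (_ : [set w | _] =
  [set w | forall i, i \in D :&: D1 -> C i (U i w)] `*`
  [set w | forall i, i \in D :\: D1 -> C i (V i w)]); last first.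
  apply/seteqP; split => -[w z] /=.
    move=> h; split=> i; rewrite inE => /andP[i1 i2].
      by have := h i i1; rewrite /mix_coords i2.
    by have := h i i2; rewrite /mix_coords (negPf i1).
  move=> [h1 h2] i iD; rewrite /mix_coords; case: ifP => iD1.
    by apply: h1; rewrite inE iD.
  by apply: h2; rewrite inE iD iD1.
rewrite /= product_measure1E; [|exact: measurable_bigcap_coords..].
apply: (etrans (congr2 (fun a b => a * b)%E (hU C mC) (hV C mC))).
rewrite [RHS](big_setID D1) /=; congr (_ * _)%E.
  by apply: eq_bigr => i; rewrite inE => /andP[_ ->].
by apply: eq_bigr => i; rewrite inE => /andP[/negPf->].
Qed.

(** Rectangles are stable under intersection; that they also generate the measurable sets makes
    uniqueness of measures applicable. A generating preimage is a rectangle with a single nontrivial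
    side. *)
Lemma measurable_tuple_rectangles :
  measurable = <<s [set A : set (n.-tuple R) | exists2 C : 'I_n -> set R,
    forall i, measurable (C i) & A = [set x | forall i, i \in [set: 'I_n]%SET -> C i (tnth x i)]] >>.
Proof.
apply/seteqP; split.
  apply: smallest_sub; first exact: smallest_sigma_algebra.
  elim/big_ind: _ => [|A B hA hB|i _]; first exact: sub0set.
    by rewrite subUset.
  move=> _ [B mB <-]; apply: sub_sigma_algebra.
  exists (fun j => if j == i then B else setT) => [j|]; first by case: ifP.
  rewrite setTI; apply/seteqP; split => x /=.
    by move=> hB j _; case: eqP => // ->.
  by move=> /(_ i); rewrite eqxx finset.in_setT; apply.
apply: smallest_sub; first exact: sigma_algebra_measurable.
move=> _ [C mC ->]; apply: measurable_bigcap_coords => // i.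
exact: measurable_tnth.
Qed.

Lemma measurable_tuple_of (d : measure_display) (T : measurableType d)
    (A : 'I_n -> T -> R) : (forall i, measurable_fun setT (A i)) ->
  measurable_fun setT (fun w => [tuple A i w | i < n]).
Proof.
move=> mA; apply/measurable_fun_tnthP => i.
by rewrite (_ : _ \o _ = A i)//; apply/funext => w /=; rewrite tnth_mktuple.
Qed.

Lemma measurable_orthant : measurable (@orthant R n).
Proof.
have := @measurable_bigcap_coords _ (n.-tuple R) [set: 'I_n]%SET
  (fun i x => tnth x i) (fun=> `[0, +oo[%classic) (fun i => @measurable_tnth _ _ n i) (fun=> measurable_itv _).
congr measurable; apply/seteqP; split => x /= h i.
  by have := h i (finset.in_setT _); rewrite in_itv /= andbT.
by rewrite in_itv /= andbT h.
Qed.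

Section Expectation.
Variable g : n.-tuple R -> R.
Hypotheses (g_meas : measurable_fun (@orthant R n) g) (g_ge0 : nonneg_valued g).

Lemma measurable_value (d : measure_display) (T : measurableType d) (A : 'I_n -> T -> R) :
  (forall i, measurable_fun setT (A i)) -> (forall i w, 0 <= A i w) ->
  measurable_fun setT (fun w => g [tuple A i w | i < n]).
Proof.
move=> mA A0; apply: (measurable_comp measurable_orthant _ g_meas).
- by move=> _ [w _ <-]; apply: orthant_mktuple.
- exact: measurable_tuple_of.
Qed.

(** The two image measures on tuples agree on rectangles, hence everywhere. The integrals are moved
    to [orthant], where [g] is measurable and nonnegative. *)
Lemma expectation_eq_rectangles (d1 d2 : measure_display)
    (T1 : measurableType d1) (T2 : measurableType d2)
    (P1 : probability T1 R) (P2 : probability T2 R)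
    (A1 : 'I_n -> T1 -> R) (A2 : 'I_n -> T2 -> R) :
  (forall i, measurable_fun setT (A1 i)) -> (forall i, measurable_fun setT (A2 i)) ->
  (forall i w, 0 <= A1 i w) -> (forall i w, 0 <= A2 i w) ->
  (forall C, (forall i, measurable (C i)) ->
     P1 [set w | forall i, C i (A1 i w)] = P2 [set w | forall i, C i (A2 i w)]) ->
  (\int[P1]_w (g [tuple A1 i w | i < n])%:E = \int[P2]_w (g [tuple A2 i w | i < n])%:E)%E.
Proof.
move=> mA1 mA2 A10 A20 same.
have m1 := measurable_tuple_of mA1; have m2 := measurable_tuple_of mA2.
pose f1 : {mfun T1 >-> n.-tuple R} :=
  HB.pack (fun w => [tuple A1 i w | i < n]) (isMeasurableFun.Build _ _ _ _ _ m1).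
pose f2 : {mfun T2 >-> n.-tuple R} :=
  HB.pack (fun w => [tuple A2 i w | i < n]) (isMeasurableFun.Build _ _ _ _ _ m2).
have push (d : measure_display) (T : measurableType d) (P : probability T R) (f : {mfun T >-> n.-tuple R}) :
    (forall w, orthant (f w)) ->
    (\int[P]_w (g (f w))%:E = \int[pushforward P f]_(x in @orthant R n) (g x)%:E)%E.
  move=> f0; rewrite ge0_integral_pushforward//.
  - by rewrite (_ : f @^-1` _ = setT)//; apply/seteqP; split => // w _; exact: f0.
  - exact: measurable_orthant.
  - exact/measurable_EFinP.
  - by move=> x; rewrite inE lee_fin => /g_ge0.
rewrite (push _ _ _ f1); last by move=> w; apply: orthant_mktuple.
rewrite (push _ _ _ f2); last by move=> w; apply: orthant_mktuple.
apply: eq_measure_integral => A mA _.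
apply: (measure_unique _ (fun=> setT) measurable_tuple_rectangles) => //.
- move=> _ _ [C mC ->] [C' mC' ->]; exists (fun i => C i `&` C' i).
    by move=> i; apply: measurableI.
  apply/seteqP; split => x /=.
    by move=> [h h'] i iT; split; [exact: h|exact: h'].
  by move=> h; split=> i iT; have [] := h i iT.
- move=> k; exists (fun=> setT) => //.
  by apply/seteqP; split.
- by rewrite bigcup_const.
- move=> _ [C mC ->]; rewrite /pushforward /preimage /=.
  have e (T : Type) (B : 'I_n -> T -> R) :
     [set w | forall i, i \in [set: 'I_n]%SET -> C i (tnth [tuple B i w | i < n] i)] =
     [set w | forall i, C i (B i w)].
    apply/seteqP; split => w /= h i; first by have := h i (finset.in_setT _); rewrite tnth_mktuple.
    by rewrite tnth_mktuple.
  apply: etrans (congr1 P1 (e _ A1)) _; rewrite same//.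
  exact/esym/(congr1 P2 (e _ A2)).
- by move=> k; rewrite [X in (X < _)%E](_ : _ = P1 setT)// probability_setT ltry.
Qed.

Lemma expectation_has_law (d1 d2 : measure_display)
    (T1 : measurableType d1) (T2 : measurableType d2)
    (P1 : probability T1 R) (P2 : probability T2 R) D nu
    (A1 : 'I_n -> T1 -> R) (A2 : 'I_n -> T2 -> R) :
  (forall i, measurable_fun setT (A1 i)) -> (forall i, measurable_fun setT (A2 i)) ->
  (forall i w, 0 <= A1 i w) -> (forall i w, 0 <= A2 i w) ->
  has_law P1 D A1 nu -> has_law P2 D A2 nu ->
  (\int[P1]_w (g [tuple restrict_coords D (A1^~ w) i | i < n])%:E =
   \int[P2]_w (g [tuple restrict_coords D (A2^~ w) i | i < n])%:E)%E.
Proof.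
move=> mA1 mA2 A10 A20 h1 h2.
have mr (d : measure_display) (T : measurableType d) (A : 'I_n -> T -> R) :
    (forall i, measurable_fun setT (A i)) ->
    forall i, measurable_fun setT (fun w => restrict_coords D (A^~ w) i).
  by move=> mA i; rewrite /restrict_coords; case: (i \in D).
apply: expectation_eq_rectangles; [exact: mr|exact: mr|..].
- by move=> i w; apply: restrict_coords_ge0.
- by move=> i w; apply: restrict_coords_ge0.
(* The coordinates outside [D] are 0. Either every side [C i] outside [D] contains 0 and only [D]
   constrains the event, or one misses 0 and both events are empty. *)
move=> C mC; have [C0|/existsNP[i /not_implyP[iD Ci]]] :=
    pselect (forall i, i \notin D -> C i 0).
  have e (T : Type) (A : 'I_n -> T -> R) :
     [set w | forall i, C i (restrict_coords D (A^~ w) i)] =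
     [set w | forall i, i \in D -> C i (A i w)].
    apply/seteqP; split => w /= h i; first by move=> iD; have := h i; rewrite /restrict_coords iD.
    by rewrite /restrict_coords; case: ifPn => [/h//|/C0].
  by rewrite !e h1// h2.
have e (T : Type) (A : 'I_n -> T -> R) :
    [set w | forall i, C i (restrict_coords D (A^~ w) i)] = set0.
  apply/seteqP; split => w //= /(_ i).
  by rewrite /restrict_coords (negPf iD).
by rewrite !e !measure0.
Qed.

End Expectation.
End RectangleLaws.

(** * Utilities and replication scores *)

(** Differences are written as sums of nonnegative terms on both sides, so that they can be
    integrated before anything is known to be finite. *)
Lemma ge0_sum_integral_le {R : realType} (d : measure_display) (T : measurableType d)
    (P : probability T R) (I : Type) (F : I -> T -> R) (fs hs : seq I) :
  (forall i, measurable_fun setT (F i)) -> (forall i w, 0 <= F i w) ->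
  (forall w, \sum_(i <- fs) F i w <= \sum_(i <- hs) F i w) ->
  (\sum_(i <- fs) \int[P]_w (F i w)%:E <= \sum_(i <- hs) \int[P]_w (F i w)%:E)%E.
Proof.
move=> mF F0 le_fh.
have mE i : measurable_fun setT (fun w => (F i w)%:E) by apply/measurable_EFinP.
have E0 i w : [set: T] w -> (0 <= (F i w)%:E)%E by rewrite lee_fin.
rewrite -!ge0_integral_sum//.
apply: ge0_le_integral => //.
- by move=> w _; apply: sume_ge0 => i _; rewrite lee_fin.
- exact: emeasurable_sum.
- exact: emeasurable_sum.
- by move=> w _; rewrite !sumEFin lee_fin.
Qed.

Lemma ge0_sum_fine_integral_le {R : realType} (d : measure_display) (T : measurableType d)
    (P : probability T R) (I : eqType) (F : I -> T -> R) (fs hs : seq I) :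
  (forall i, measurable_fun setT (F i)) -> (forall i w, 0 <= F i w) ->
  {in fs ++ hs, forall i, (\int[P]_w (F i w)%:E)%E \is a fin_num} ->
  (forall w, \sum_(i <- fs) F i w <= \sum_(i <- hs) F i w) ->
  \sum_(i <- fs) fine (\int[P]_w (F i w)%:E) <= \sum_(i <- hs) fine (\int[P]_w (F i w)%:E).
Proof.
move=> mF F0 fin le_fh; have := ge0_sum_integral_le P mF F0 le_fh.
have conv (s : seq I) : {subset s <= fs ++ hs} ->
    (\sum_(i <- s) \int[P]_w (F i w)%:E = (\sum_(i <- s) fine (\int[P]_w (F i w)%:E))%:E)%E.
  move=> sub; rewrite -sumEFin !big_seq; apply: eq_bigr => i is_.
  by rewrite fineK// fin// sub.
by rewrite !conv ?lee_fin// => i is_; rewrite mem_cat is_ ?orbT.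
Qed.

Lemma probability_integral_cst {R : realType} (d : measure_display) (T : measurableType d)
    (P : probability T R) (c : R) : (\int[P]_w c%:E = c%:E)%E.
Proof.
rewrite integral_cst//.
by apply: etrans (congr1 (fun v => _ * v)%E (probability_setT P)) _; rewrite mule1.
Qed.

Lemma exists_perm_initial n (D : {set 'I_n}) :
  exists s : {perm 'I_n}, forall i : 'I_n, (s i \in D) = (i < #|D|)%N.
Proof.
pose t := enum D ++ enum (~: D).
have szt : size t == n by rewrite size_cat -!cardE cardsC card_ord.
have /tuple_permP[s ts] : perm_eq (Tuple szt) (ord_tuple n).
  apply: uniq_perm => [||i].
  - rewrite cat_uniq !enum_uniq andbT /=; apply/hasPn => i.
    by rewrite !mem_enum inE.
  - by rewrite val_ord_tuple enum_uniq.
  - by rewrite mem_cat !mem_enum !inE orbN.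
exists s => i; have -> : s i = nth i t i.
  rewrite -[t]/(tval (Tuple szt)) ts /= (nth_map i) ?size_enum_ord//.
  by rewrite tnth_ord_tuple nth_ord_enum.
rewrite nth_cat -cardE; case: ltnP => iD.
  by rewrite -mem_enum mem_nth// -cardE.
have : nth i (enum (~: D)) (i - #|D|) \in ~: D.
  rewrite -mem_enum mem_nth// -cardE -(ltn_add2l #|D|) cardsC subnKC//.
  by rewrite card_ord.
by rewrite inE => /negPf.
Qed.

Section ScoreBounds.
Context {R : realType} {n : nat} {g : n.-tuple R -> R}
  {d : measure_display} {T : measurableType d} {P : probability T R}
  {X : 'I_n -> {RV P >-> R}}
  {d' : measure_display} {T' : measurableType d'} {Q : probability T' R}
  {Y : 'I_n -> 'I_n -> {RV Q >-> R}} {k : nat}.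
Hypotheses (kn : (k <= n)%N) (g_meas : measurable_fun (@orthant R n) g)
  (g_ge0 : nonneg_valued g) (g_sym : symmetric_fun g)
  (g_nd : nondecreasing_value g) (g_sub : submodular g)
  (X_ge0 : forall i w, 0 <= X i w) (X_indep : mutually_independent X)
  (Y_ge0 : forall i j w, 0 <= Y i j w) (Y_indep : forall i, mutually_independent (Y i))
  (XY : forall i j, same_distribution (X i) (Y i j))
  (u_fin : forall S : {set 'I_n}, (#|S| <= k)%N -> utility g X S \is a fin_num)
  (a_fin : forall i r, (1 <= r <= k)%N -> replication_score g (Y i) r \is a fin_num).

Local Notation G f := (g [tuple f i | i < n]).
Implicit Types S D : {set 'I_n}.
Local Notation lt_set p := [set c : 'I_n | (c < p)%N]%SET.

Let mu (i : 'I_n) (B : set R) : \bar R := P (X i @^-1` B).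
Let u (S : {set 'I_n}) : R := fine (utility g X S).
Let a (i : 'I_n) (r : nat) : R := fine (replication_score g (Y i) r).

Let mX i : measurable_fun setT (X i). Proof. exact: measurable_funPT. Qed.
Let mY i j : measurable_fun setT (Y i j). Proof. exact: measurable_funPT. Qed.

Lemma has_law_items D : has_law P D (fun i => X i) mu.
Proof. by move=> C mC; exact: X_indep. Qed.

Lemma has_law_copies i D : has_law Q D (fun j => Y i j) (fun=> mu i).
Proof.
move=> C mC; apply: etrans (Y_indep i D mC) _.
by apply: eq_bigr => j _; rewrite /mu; apply/esym/XY.
Qed.

Lemma has_law_single i (p : 'I_n) : has_law P [set p]%SET (fun=> X i) (fun=> mu i).
Proof.
move=> C mC; rewrite big_set1; congr (P _); apply/seteqP; split => w /=.
  by apply; rewrite inE.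
by move=> h c; rewrite inE => /eqP->.
Qed.

Lemma utilityE S :
  utility g X S = (\int[P]_w (G (restrict_coords S (fun i => X i w)))%:E)%E.
Proof.
rewrite /utility unlock; apply: eq_integral => w _; congr (g _)%:E.
by apply: eq_mktuple => i; rewrite tnth_mktuple.
Qed.

Lemma replication_scoreE i r :
  replication_score g (Y i) r =
  (\int[Q]_w (G (restrict_coords (lt_set r) (fun j => Y i j w)))%:E)%E.
Proof.
rewrite /replication_score unlock; apply: eq_integral => w _; congr (g _)%:E.
by apply: eq_mktuple => j; rewrite /restrict_coords inE.
Qed.

(** Symmetry carries [D] to an initial segment, and permuting independent copies preserves their
    law. Copies may therefore sit on any coordinates. *)
Lemma score_positions i D :
  (\int[Q]_w (G (restrict_coords D (fun j => Y i j w)))%:E)%E =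
  replication_score g (Y i) #|D|.
Proof.
have [s sD] := exists_perm_initial D.
rewrite replication_scoreE.
transitivity (\int[Q]_w (G (restrict_coords (lt_set #|D|) (fun j => Y i (s j) w)))%:E)%E.
  apply: eq_integral => w _; congr _%:E.
  rewrite -(value_permute g_sym s); last exact: restrict_coords_ge0.
  by apply: value_ext => c; rewrite /restrict_coords sD inE.
apply: (expectation_has_law g_meas g_ge0 (nu := fun=> mu i)) => //.
- exact: has_law_permute (has_law_copies i _).
- exact: has_law_copies.
Qed.

Let measurable_item_value D :
  measurable_fun setT (fun w => G (restrict_coords D (fun i => X i w))).
Proof.
apply: (measurable_value g_meas) => [i|i w]; last exact: restrict_coords_ge0.
by rewrite /restrict_coords; case: (i \in D).
Qed.

Let measurable_copy_value i D :
  measurable_fun setT (fun w => G (restrict_coords D (fun j => Y i j w))).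
Proof.
apply: (measurable_value g_meas) => [j|j w]; last exact: restrict_coords_ge0.
by rewrite /restrict_coords; case: (j \in D).
Qed.

Lemma utility_le S S' : (#|S'| <= k)%N -> S \subset S' -> u S <= u S'.
Proof.
move=> S'k SS'; have Sk := leq_trans (subset_leq_card SS') S'k.
have := @ge0_sum_fine_integral_le _ _ _ P _
  (fun D w => G (restrict_coords D (fun i => X i w))) [:: S] [:: S'] measurable_item_value.
rewrite !big_seq1 /u !utilityE; apply.
- by move=> D w; apply/(value_ge0 g_ge0)/restrict_coords_ge0.
- by move=> D; rewrite !inE => /orP[] /eqP->; rewrite -utilityE; apply: u_fin.
- move=> w; rewrite !big_seq1; apply: (value_le g_nd); first exact: restrict_coords_ge0.
  move=> i; rewrite /restrict_coords; case: ifP => iS; first by rewrite (fintype.subsetP SS').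
  by case: ifP.
Qed.

Lemma utility_marginal_sum S : (#|S| <= k)%N ->
  \sum_(j in S) (u S - u (S :\ j)) <= u S.
Proof.
move=> Sk.
have := @ge0_sum_fine_integral_le _ _ _ P _
  (fun D w => G (restrict_coords D (fun i => X i w)))
  [seq S | j <- enum S] (S :: [seq S :\ j | j <- enum S]) measurable_item_value.
rewrite big_cons !big_map.
under eq_bigr do rewrite -utilityE.
under [X in _ <= _ + X]eq_bigr do rewrite -utilityE.
rewrite -utilityE !big_enum /= sumrB -/(u S) => h; rewrite lerBlDr; apply: h.
- by move=> D w; apply/(value_ge0 g_ge0)/restrict_coords_ge0.
- move=> D hD; rewrite -utilityE; apply: u_fin; move: hD.
  rewrite mem_cat inE => /or3P[/mapP[j _ ->]//|/eqP->//|/mapP[j _ ->]].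
  by apply: leq_trans Sk; apply/subset_leq_card/subsetDl.
- move=> w; rewrite big_cons !big_map !big_enum /= -lerBlDr -sumrB.
  exact: (value_marginal_sum g_ge0 g_nd g_sub).
Qed.

Lemma score0E i : replication_score g (Y i) 0 = (g (pad n [::]))%:E.
Proof.
rewrite replication_scoreE.
rewrite (eq_integral (fun=> (g (pad n [::]))%:E)) => [|w _].
  exact: probability_integral_cst.
congr _%:E; apply: value_ext => j; rewrite /restrict_coords inE ltn0.
by rewrite nth_nil.
Qed.

Lemma score_fin i r : (r <= k)%N -> replication_score g (Y i) r \is a fin_num.
Proof. by case: r => [_|r rk]; [rewrite score0E|apply: a_fin]. Qed.

(** Integrated marginal sum over r+1 copies: all deletions have the same mean, by [score_positions].
    This bounds the increments of the scores in the upper bound. *)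
Lemma score_marginal_le i r : (r < k)%N ->
  r.+1%:R * (a i r.+1 - a i r) <= a i r.+1.
Proof.
move=> rk; have rn : (r < n)%N by apply: leq_trans kn.
pose S := lt_set r.+1.
have SE : #|S| = r.+1 by rewrite card_lt_set.
have SjE j : j \in S -> #|S :\ j| = r.
  by move=> jS; have := cardsD1 j S; rewrite jS SE => -[].
pose fs := [seq S | j <- enum S]; pose hs := S :: [seq S :\ j | j <- enum S].
have fin : {in fs ++ hs, forall D,
    (\int[Q]_w (G (restrict_coords D (fun j => Y i j w)))%:E)%E \is a fin_num}.
  move=> D hD; rewrite score_positions; apply: score_fin; move: hD.
  rewrite mem_cat inE => /or3P[/mapP[j _ ->]|/eqP->|/mapP[j]]; rewrite ?SE//.
  by rewrite mem_enum => jS ->; rewrite SjE// ltnW.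
have pw w : \sum_(D <- fs) G (restrict_coords D (fun j => Y i j w)) <=
            \sum_(D <- hs) G (restrict_coords D (fun j => Y i j w)).
  rewrite big_cons !big_map !big_enum /= -lerBlDr -sumrB.
  exact: (value_marginal_sum g_ge0 g_nd g_sub).
have := ge0_sum_fine_integral_le (measurable_copy_value i)
  (fun D w => value_ge0 g_ge0 (restrict_coords_ge0 D (fun j => Y_ge0 i j w))) fin pw.
rewrite big_cons !big_map !big_enum /= score_positions SE sumr_const SE -/(a i r.+1).
rewrite (eq_bigr (fun=> a i r)) => [|j jS]; last by rewrite score_positions SjE.
by rewrite sumr_const SE mulr_natl mulrnBl lerBlDr.
Qed.

Lemma score_nd i r : (r < k)%N -> a i r <= a i r.+1.
Proof.
move=> rk.
have := @ge0_sum_fine_integral_le _ _ _ Q _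
  (fun D w => G (restrict_coords D (fun j => Y i j w)))
  [:: lt_set r] [:: lt_set r.+1] (measurable_copy_value i).
rewrite !big_seq1 /a !replication_scoreE; apply.
- by move=> D w; apply/(value_ge0 g_ge0)/restrict_coords_ge0.
- by move=> D; rewrite !inE => /orP[] /eqP->; rewrite -replication_scoreE;
    apply: score_fin => //; apply: ltnW.
- move=> w; rewrite !big_seq1; apply: (value_le g_nd); first exact: restrict_coords_ge0.
  move=> c; rewrite /restrict_coords !inE; case: ltnP => cr; last by case: ifP.
  by rewrite ltnS ltnW.
Qed.

(** * Vectors mixing items with copies of one item, and the lower bound on the utility *)

Let mixXY j D1 := mix_coords D1 (fun c => X c) (fun c => Y j c).
(** In the pair [p], the first set holds the coordinates kept and the second those filled with
    items; the others are filled with copies of [j]. *)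
Let mix_value j (p : {set 'I_n} * {set 'I_n}) w : R :=
  G (restrict_coords p.1 (fun c => mixXY j p.2 c w)).
Let mix_mean j p : \bar R := (\int[(P \x Q)%E]_w (mix_value j p w)%:E)%E.

Let mixXY_ge0 j D1 c w : 0 <= mixXY j D1 c w.
Proof. by rewrite /mixXY /mix_coords; case: ifP. Qed.

Let measurable_mixXY j D1 c : measurable_fun setT (mixXY j D1 c).
Proof. exact: measurable_mix_coords. Qed.

Let measurable_mix_value j p : measurable_fun setT (mix_value j p).
Proof.
apply: (measurable_value g_meas) => [c|c w]; last exact: restrict_coords_ge0.
by rewrite /restrict_coords; case: (c \in p.1).
Qed.

Let mix_value_ge0 j p w : 0 <= mix_value j p w.
Proof. by apply/(value_ge0 g_ge0)/restrict_coords_ge0. Qed.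

Let has_law_mixXY j D1 D :
  has_law (P \x Q)%E D (mixXY j D1) (fun c => if c \in D1 then mu c else mu j).
Proof.
exact: (has_law_mix mX (mY j) (has_law_items _) (has_law_copies j _)).
Qed.

(** A copy of [j] placed on coordinate [j] has the law of the item itself, so the mixture has the
    law of the items. *)
Lemma mix_mean_items j D D1 : (forall c, c \in D -> c \notin D1 -> c = j) ->
  mix_mean j (D, D1) = utility g X D.
Proof.
move=> hD; rewrite utilityE.
apply: (expectation_has_law g_meas g_ge0 (nu := mu)) => //; last exact: has_law_items.
apply: has_law_ext (has_law_mixXY j D1 D) => c B cD _.
by case: ifPn => // /(hD _ cD) ->.
Qed.

Lemma mix_mean_copies j D : mix_mean j (D, finset.set0) = replication_score g (Y j) #|D|.
Proof.
rewrite -score_positions.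
apply: (expectation_has_law g_meas g_ge0 (nu := fun=> mu j)) => //; last exact: has_law_copies.
by apply: has_law_ext (has_law_mixXY j finset.set0 D) => c B cD _; rewrite finset.in_set0.
Qed.

(** With a copy of [j] on coordinate [i] and coordinate [j] deleted, the vector has the law of the
    items permuted by [tperm i j]. *)
Lemma mix_mean_swap i j D : i \in D -> j \in D -> i != j ->
  mix_mean j (D :\ j, [set~ i]%SET) = utility g X (D :\ i).
Proof.
move=> iD jD ij; rewrite utilityE.
transitivity (\int[P]_w (G (restrict_coords (D :\ j) (fun c => X (tperm i j c) w)))%:E)%E; last first.
  apply: eq_integral => w _; congr _%:E.
  rewrite -[RHS](value_permute g_sym (tperm i j)); last exact: restrict_coords_ge0.
  apply: value_ext => c; rewrite /restrict_coords !inE.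
  have [->|ci] := eqVneq c i; first by rewrite tpermL ij eq_sym ij iD jD.
  have [->|cj] := eqVneq c j; first by rewrite tpermR eqxx.
  have -> : tperm i j c = c by rewrite tpermD// eq_sym.
  by rewrite (negPf ci).
apply: (expectation_has_law g_meas g_ge0 (nu := fun c => mu (tperm i j c))) => //.
  apply: has_law_ext (has_law_mixXY j _ _) => c B; rewrite !inE => /andP[cj _] _.
  by have [->|ci] := eqVneq c i; rewrite ?tpermL// tpermD// eq_sym.
exact: (has_law_permute (s := tperm i j) (has_law_items _)).
Qed.

(** Raising coordinate [i] to a maximum gains at most what the copy alone gains over the vector
    without [i]. *)
Let mix_value_replace j S w i : i \in S ->
  G (fun c => if c == i
      then Num.max (restrict_coords S (fun c => X c w.1) c) (restrict_coords S (fun c => Y j c w.2) c)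
      else restrict_coords S (fun c => X c w.1) c) + mix_value j (S :\ i, [set: 'I_n]%SET) w <=
  mix_value j (S, [set: 'I_n]%SET) w + mix_value j (S, [set~ i]%SET) w.
Proof.
move=> iS; apply: (value_exchange g_nd g_sub) => c; rewrite ?restrict_coords_ge0//.
- rewrite /restrict_coords /mixXY /mix_coords !inE.
  have [->|ci] := eqVneq c i; first by rewrite iS /= le_max X_ge0 lexx.
  by case: ifP => _ /=; rewrite ?X_ge0 ?le_max lexx.
- rewrite /= /restrict_coords /mixXY /mix_coords !inE.
  have [->|ci] := eqVneq c i; first by rewrite iS /= le_min X_ge0 Y_ge0.
  by case: ifP => _ /=; rewrite le_min !lexx.
Qed.

(** A copy of [j] gains at most as much over S minus i as over S minus i and j. By [mix_mean_swap]
    the latter gain is a difference of utilities. *)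
Lemma mix_mean_replace_le i j S : i \in S -> j \in S -> i != j ->
  (mix_mean j (S, [set~ i]%SET) + utility g X (S :\ i :\ j) <=
   utility g X (S :\ i) + utility g X (S :\ i))%E.
Proof.
move=> iS jS ij.
have := @ge0_sum_integral_le _ _ _ (P \x Q)%E _ (mix_value j)
  [:: (S, [set~ i]%SET); (S :\ i :\ j, [set: 'I_n]%SET)]
  [:: (S :\ i, [set: 'I_n]%SET); (S :\ j, [set~ i]%SET)]
  (measurable_mix_value j) (mix_value_ge0 j).
have allT D c : c \in D -> c \notin [set: 'I_n]%SET -> c = j by rewrite inE.
rewrite !big_cons !big_nil !adde0 -!/(mix_mean j _) mix_mean_swap// !(mix_mean_items (@allT _)).
apply=> w; rewrite !big_cons !big_nil !addr0.
apply: (value_exchange g_nd g_sub) => c; rewrite ?restrict_coords_ge0//=.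
- rewrite /restrict_coords /mixXY /mix_coords !inE le_max.
  have [->|ci] := eqVneq c i; first by rewrite iS ij /= lexx orbT.
  by case: ifP => _ /=; rewrite ?lexx.
- rewrite /restrict_coords /mixXY /mix_coords !inE le_min.
  have [->|cj] := eqVneq c j; first by rewrite lexx eq_sym ij jS X_ge0.
  have [->|ci] := eqVneq c i; first by rewrite lexx iS Y_ge0.
  by case: ifP => _ /=; rewrite ?lexx.
Qed.

Let subset_card_le S i : (#|S| <= k)%N -> (#|S :\ i| <= k)%N.
Proof. by apply: leq_trans; apply/subset_leq_card/subsetDl. Qed.

(** The finiteness hypotheses concern pure vectors only; that of a mixture follows from the
    preceding bound by utilities. *)
Lemma mix_mean_fin i j S : i \in S -> j \in S -> (#|S| <= k)%N ->
  mix_mean j (S, [set~ i]%SET) \is a fin_num.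
Proof.
move=> iS jS Sk; have [->|ij] := eqVneq i j.
  by rewrite mix_mean_items ?u_fin// => c _; rewrite !inE negbK => /eqP.
have := mix_mean_replace_le iS jS ij; set m := mix_mean _ _ => mle.
have m0 : (0 <= m)%E by apply: integral_ge0 => w _; rewrite lee_fin.
have u0 D : (0 <= utility g X D)%E.
  rewrite utilityE; apply: integral_ge0 => w _; rewrite lee_fin.
  by apply/(value_ge0 g_ge0)/restrict_coords_ge0.
rewrite ge0_fin_numE//; apply: (@le_lt_trans _ _ (m + utility g X (S :\ i :\ j))%E).
  exact: leeDl.
apply: le_lt_trans mle _.
by rewrite lte_add_pinfty// -ge0_fin_numE// u_fin// subset_card_le.
Qed.

(** The copies lie below the join of items and copies, which is reached from the items one
    coordinate at a time. The replacement at i = j leaves the law of the items unchanged; the others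
    are bounded by [mix_mean_replace_le]. *)
Lemma score_le_marginals j S : j \in S -> (#|S| <= k)%N ->
  a j #|S| + \sum_(i in S) u (S :\ i) <=
  u S + (u S + \sum_(i in S :\ j) (2 * u (S :\ i) - u (S :\ i :\ j))).
Proof.
move=> jS Sk.
pose fs := (S, finset.set0) :: [seq (S :\ i, [set: 'I_n]%SET) | i <- enum S].
pose hs := (S, [set: 'I_n]%SET) :: [seq (S, [set~ i]%SET) | i <- enum S].
have allT D c : c \in D -> c \notin [set: 'I_n]%SET -> c = j by rewrite inE.
have fin : {in fs ++ hs, forall p, (\int[(P \x Q)%E]_w (mix_value j p w)%:E)%E \is a fin_num}.
  move=> p; rewrite mem_cat !inE => /orP[/orP[/eqP->|/mapP[i _ ->]]|/orP[/eqP->|/mapP[i]]].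
  - rewrite -/(mix_mean j _) mix_mean_copies; apply: score_fin; exact: Sk.
  - by rewrite -/(mix_mean j _) (mix_mean_items (@allT _)) u_fin// subset_card_le.
  - by rewrite -/(mix_mean j _) (mix_mean_items (@allT _)) u_fin.
  - by rewrite mem_enum => iS ->; exact: mix_mean_fin.
have pw w : \sum_(p <- fs) mix_value j p w <= \sum_(p <- hs) mix_value j p w.
  pose x c := restrict_coords S (fun c => X c w.1) c.
  pose y c := restrict_coords S (fun c => Y j c w.2) c.
  have x0 c : 0 <= x c by apply: restrict_coords_ge0.
  have y0 c : 0 <= y c by apply: restrict_coords_ge0.
  have raise := value_raise_sum g_nd g_sub (enum S) x0 y0.
  have -> : \sum_(p <- hs) mix_value j p w = G x + \sum_(i in S) mix_value j (S, [set~ i]%SET) w.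
    rewrite big_cons big_map big_enum /=; congr (_ + _); apply: value_ext => c.
    by rewrite /restrict_coords /mixXY /mix_coords inE.
  have -> : \sum_(p <- fs) mix_value j p w = G y + \sum_(i in S) mix_value j (S :\ i, [set: 'I_n]%SET) w.
    rewrite big_cons big_map big_enum /=; congr (_ + _); apply: value_ext => c.
    by rewrite /restrict_coords /mixXY /mix_coords inE.
  have yle : G y <= G (fun c => if c \in enum S then Num.max (x c) (y c) else x c).
    apply: (value_le g_nd) => // c; rewrite mem_enum; case: ifP => cS; first by rewrite le_max lexx orbT.
    by rewrite /x /y /restrict_coords cS.
  suff : \sum_(i <- enum S) (G (fun c => if c == i then Num.max (x c) (y c) else x c) - G x) <=
      \sum_(i in S) mix_value j (S, [set~ i]%SET) w -
      \sum_(i in S) mix_value j (S :\ i, [set: 'I_n]%SET) w.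
    by move=> h; have := le_trans raise h; move: yle; lra.
  rewrite -sumrB big_enum /=; apply: ler_sum => i iS.
  have := mix_value_replace j w iS.
  have -> : mix_value j (S, [set: 'I_n]%SET) w = G x.
    by apply: value_ext => c; rewrite /restrict_coords /mixXY /mix_coords inE.
  by rewrite /x /y; lra.
have := ge0_sum_fine_integral_le (measurable_mix_value j) (mix_value_ge0 j) fin pw.
rewrite !big_cons !big_map !big_enum /= -!/(mix_mean j _) mix_mean_copies -/(a j _).
rewrite (mix_mean_items (@allT _)) -/(u S).
rewrite (eq_bigr (fun i => u (S :\ i))) => [|i iS]; last by rewrite -/(mix_mean j _) (mix_mean_items (@allT _)).
move=> h; apply: le_trans h _; rewrite lerD2l (bigD1 j)//=.
rewrite -/(mix_mean j _) mix_mean_items => [|c _]; last by rewrite !inE negbK => /eqP.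
rewrite -/(u S) lerD2l.
rewrite [X in _ <= X](eq_bigl (fun i => (i \in S) && (i != j))); last first.
  by move=> i; rewrite !inE andbC.
apply: ler_sum => i /andP[iS ij].
have := mix_mean_replace_le iS jS ij.
rewrite -(fineK (mix_mean_fin iS jS Sk)).
rewrite -(fineK (u_fin (subset_card_le j (subset_card_le i Sk)))).
rewrite -(fineK (u_fin (subset_card_le i Sk))) -!EFinD lee_fin.
by rewrite -!/(u _) -/(mix_mean j _); lra.
Qed.

Lemma sum_scores_le S : (#|S| <= k)%N ->
  \sum_(j in S) a j #|S| <= 2 * #|S|%:R * u S.
Proof.
move=> Sk.
have H j : j \in S -> a j #|S| <= u S + (u S - u (S :\ j)) +
    \sum_(i in S :\ j) (u (S :\ i) - u (S :\ i :\ j)).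
  move=> jS; have := score_le_marginals jS Sk.
  rewrite (bigD1 j)//= [X in _ + (_ + X) <= _](eq_bigl (mem (S :\ j))); last first.
    by move=> i; rewrite !inE andbC.
  under [X in _ <= _ + (_ + X) -> _]eq_bigr do rewrite mulr_natl mulr2n -addrA.
  by rewrite big_split /=; lra.
apply: le_trans (ler_sum _ H) _; rewrite 2!big_split /=.
(* For fixed i the inner sum becomes the marginal sum of [S :\ i], hence at most [u (S :\ i)]. This
   cancels the negative terms, leaving two copies of [u S] for each element. *)
have -> : \sum_(j in S) \sum_(i in S :\ j) (u (S :\ i) - u (S :\ i :\ j)) =
          \sum_(i in S) \sum_(j in S :\ i) (u (S :\ i) - u (S :\ i :\ j)).
  rewrite (exchange_big_dep (mem S)) /=; last by move=> j i _; rewrite inE => /andP[].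
  apply: eq_bigr => i iS; apply: eq_bigl => j; rewrite !inE iS andbT.
  by rewrite andbC eq_sym.
have : \sum_(i in S) \sum_(j in S :\ i) (u (S :\ i) - u (S :\ i :\ j)) <= \sum_(i in S) u (S :\ i).
  by apply: ler_sum => i iS; apply: utility_marginal_sum; apply: subset_card_le.
rewrite sumrB !sumr_const -mulr_natl; lra.
Qed.

(** A lower bound on all the scores is at most their average, and the utility grows from [S] to
    [S']. *)
Lemma min_score_le S S' (b : R) : (0 < #|S|)%N -> (#|S'| <= k)%N -> S \subset S' ->
  (forall j, j \in S -> b <= a j #|S|) -> b <= 2 * u S'.
Proof.
move=> S0 S'k SS' hb; have Sk := leq_trans (subset_leq_card SS') S'k.
have Sr : 0 < #|S|%:R :> R by rewrite ltr0n.
have : #|S|%:R * b <= #|S|%:R * (2 * u S).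
  rewrite mulrA [_ * 2]mulrC; apply: le_trans (sum_scores_le Sk).
  by rewrite mulr_natl -sumr_const; apply: ler_sum.
rewrite ler_pM2l// => h; apply: le_trans h _.
by rewrite ler_pM2l//; apply: utility_le.
Qed.


(** * Samples of copies followed by a fixed value, and the upper bound on the utility *)

Definition copies_then i (p : nat) (w : T') (z : R) (c : 'I_n) : R :=
  if (c < p)%N then Y i c w else if c == p :> nat then z else 0.

Let copies_then_ge0 i p w z c : 0 <= z -> 0 <= copies_then i p w z c.
Proof. by move=> z0; rewrite /copies_then; case: ifP => // _; case: ifP. Qed.

Let first_copies i p w : seq R := [seq Y i c w | c <- take p (enum 'I_n)].

Let size_first_copies i p w : (p <= n)%N -> size (first_copies i p w) = p.
Proof. by move=> pn; rewrite size_map size_takel// size_enum_ord. Qed.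

Let nth_first_copies i p w (c : 'I_n) : (c < p)%N -> nth 0 (first_copies i p w) c = Y i c w.
Proof.
move=> cp; rewrite (nth_map c); last by rewrite size_take_min size_enum_ord leq_min cp ltn_ord.
by rewrite nth_take// nth_ord_enum.
Qed.

Lemma pad_first_copies i p w : (p <= n)%N ->
  g (pad n (first_copies i p w)) = G (restrict_coords (lt_set p) (fun c => Y i c w)).
Proof.
move=> pn; apply: value_ext => c; rewrite /restrict_coords inE.
by case: ltnP => pc; [rewrite nth_first_copies|rewrite nth_default// size_first_copies].
Qed.

Lemma pad_rcons_first_copies i p w z : (p < n)%N ->
  g (pad n (rcons (first_copies i p w) z)) = G (copies_then i p w z).
Proof.
move=> pn; apply: value_ext => c; rewrite /copies_then nth_rcons size_first_copies; last exact: ltnW.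
by case: (ltnP c p) => // pc; rewrite nth_first_copies.
Qed.

Let mean_then i p z : \bar R := (\int[Q]_w (G (copies_then i p w z))%:E)%E.

Let copies_thenE i (p : 'I_n) w w' c : copies_then i p w (X i w') c =
  restrict_coords (lt_set p.+1)
    (fun c => mix_coords [set~ p]%SET (fun c => Y i c) (fun=> X i) c (w, w')) c.
Proof.
rewrite /copies_then /restrict_coords /mix_coords !inE ltnS.
by rewrite -(inj_eq val_inj) /=; case: ltngtP.
Qed.

Let measurable_copies_then i (p : 'I_n) :
  measurable_fun setT (fun w : T' * T => (G (copies_then i p w.1 (X i w.2)))%:E).
Proof.
apply/measurable_EFinP; apply: (measurable_value g_meas) => [c|c w]; last exact: copies_then_ge0.
rewrite /copies_then; case: (c < p)%N.
  exact: measurableT_comp (mY i c) measurable_fst.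
case: (_ == _) => //; exact: measurableT_comp (mX i) measurable_snd.
Qed.

(** By Tonelli, an independent value of item i appended to p copies acts as one more copy. *)
Lemma mean_then_item i (p : 'I_n) :
  (\int[P]_w mean_then i p (X i w) = replication_score g (Y i) p.+1)%E.
Proof.
have f0 (w : T' * T) : (0 <= (G (copies_then i p w.1 (X i w.2)))%:E)%E.
  by rewrite lee_fin; apply: (value_ge0 g_ge0) => c; exact: copies_then_ge0.
have := @fubini_tonelli2 _ _ _ _ _ Q P _ (measurable_copies_then i p) f0.
rewrite /fubini_G /= -/(mean_then i p _) => <-.
rewrite replication_scoreE.
under eq_integral => w _ do under eq_mktuple => c do rewrite copies_thenE -surjective_pairing.
apply: (expectation_has_law g_meas g_ge0 (nu := fun=> mu i)
  (A1 := mix_coords [set~ p]%SET (fun c => Y i c) (fun=> X i))) => //.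
- by apply: measurable_mix_coords => c; [exact: mY|exact: mX].
- by move=> c w; rewrite /mix_coords; case: ifP.
- apply: has_law_ext (has_law_mix (nu := fun=> mu i) (nu' := fun=> mu i) (mY i) (fun=> mX i) _ _).
  + by move=> c B _ _; case: ifP.
  + exact: has_law_copies.
  + rewrite (_ : _ :\: _ = [set p]%SET); first exact: has_law_single.
    by apply/setP => c; rewrite !inE negbK; case: eqVneq => // ->; rewrite ltnS leqnn.
- exact: has_law_copies.
Qed.

Lemma measurable_mean_then i (p : 'I_n) :
  measurable_fun setT (fun w => mean_then i p (X i w)).
Proof.
apply: (@measurable_fun_fubini_tonelli_G _ _ _ _ _ Q _ (measurable_copies_then i p)) => w.
by rewrite lee_fin; apply: (value_ge0 g_ge0) => c; exact: copies_then_ge0.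
Qed.

Lemma copies_le_copies_then i p w z : (p < n)%N -> 0 <= z ->
  G (restrict_coords (lt_set p) (fun c => Y i c w)) <= G (copies_then i p w z).
Proof.
move=> pn z0; apply: (value_le g_nd); first exact: restrict_coords_ge0.
move=> c; rewrite /restrict_coords /copies_then inE; case: ifP => // _.
by case: ifP.
Qed.

(* Markov's inequality: the samples with value at most [2 b] have probability
   at least 1/2, so on one of them the marginal of [z] is at most twice its mean. *)
Lemma exists_low_sample i p z (b e : R) : (p < k)%N -> 0 <= z -> 0 < b -> 0 < e ->
  a i p <= b -> (mean_then i p z < +oo)%E ->
  exists w, G (restrict_coords (lt_set p) (fun c => Y i c w)) <= 2 * b /\
    G (copies_then i p w z) - G (restrict_coords (lt_set p) (fun c => Y i c w)) <=
    2 * (fine (mean_then i p z) - a i p) + e.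
Proof.
move=> pk z0 b0 e0 ab Afin; have pn : (p < n)%N by apply: leq_trans kn.
pose gY w := G (restrict_coords (lt_set p) (fun c => Y i c w)).
pose h w := G (copies_then i p w z).
have gY0 w : 0 <= gY w by apply/(value_ge0 g_ge0)/restrict_coords_ge0.
have h0 w : 0 <= h w by apply: (value_ge0 g_ge0) => c; exact: copies_then_ge0.
have mgY : measurable_fun setT (EFin \o gY) by apply/measurable_EFinP/measurable_copy_value.
have mh : measurable_fun setT (EFin \o h).
  apply/measurable_EFinP; apply: (measurable_value g_meas) => [c|c w]; last exact: copies_then_ge0.
  by rewrite /copies_then; case: (c < p)%N => //; case: (_ == _).
have gYE : (\int[Q]_w (gY w)%:E = (a i p)%:E)%E.
  by rewrite fineK ?replication_scoreE// -replication_scoreE score_fin// ltnW.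
have hE : (\int[Q]_w (h w)%:E = (fine (mean_then i p z))%:E)%E.
  by rewrite fineK// ge0_fin_numE//; apply: integral_ge0 => w _; rewrite lee_fin; exact: h0.
set A := fine _ in hE *.
have aA : a i p <= A.
  rewrite -lee_fin -gYE -hE; apply: ge0_le_integral => //.
  - by move=> w _; rewrite lee_fin.
  - by move=> w _; rewrite lee_fin; apply: copies_le_copies_then.
set m := _ + e; have m0 : 0 < m by rewrite /m; lra.
apply: contrapT => /forallNP noW.
(* This weight makes [r * gY] at least m wherever [gY] exceeds 2 b. If no sample works, the
   pointwise inequality [pw] integrates to m <= (A - a) + m / 2, contradicting m > 2 (A - a). *)
pose r := m / (2 * b).
have r0 : 0 <= r by apply: divr_ge0; lra.
have rb : r * (2 * b) = m by rewrite /r divfK//; lra.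
have pw w : gY w + m <= h w + r * gY w.
  have gh : gY w <= h w by apply: copies_le_copies_then.
  have [gb|gb] := leP (gY w) (2 * b).
    have : ~ (h w - gY w <= m) by move=> hm; apply: (noW w).
    move=> /negP; rewrite -ltNge => ?.
    have : 0 <= r * gY w by apply: mulr_ge0.
    lra.
  have : r * (2 * b) <= r * gY w by rewrite ler_wpM2l// ltW.
  lra.
have : (\int[Q]_w ((gY w)%:E + m%:E) <= \int[Q]_w ((h w)%:E + r%:E * (gY w)%:E))%E.
  apply: ge0_le_integral => //.
  - by move=> w _; rewrite -EFinD lee_fin addr_ge0// ltW.
  - by apply: emeasurable_funD.
  - by apply: emeasurable_funD => //; apply: emeasurable_funM.
  - by move=> w _; rewrite -EFinM -!EFinD lee_fin.
rewrite ge0_integralD//; last 2 first.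
  by move=> w _; rewrite lee_fin.
  by move=> w _; rewrite lee_fin ltW.
rewrite ge0_integralD//; last 3 first.
  by move=> w _; rewrite lee_fin.
  by move=> w _; rewrite -EFinM lee_fin mulr_ge0.
  exact: emeasurable_funM.
rewrite ge0_integralZl_EFin//; last by move=> w _; rewrite lee_fin.
rewrite gYE hE probability_integral_cst.
rewrite -EFinM -!EFinD lee_fin.
have : r * a i p <= r * b by rewrite ler_wpM2l.
rewrite /m in rb *; lra.
Qed.

(** For each outcome [w] low samples are chosen and the pointwise harmonic bound is applied. Only
    means over the samples survive in [mean_le_sum], so the choice need not be measurable in [w]. *)
Lemma utility_le_harmonic S (l : seq 'I_n) (b : R) : uniq l -> l =i S ->
  (0 < size l <= k)%N -> 0 <= b ->
  (forall i0 p, (p < size l)%N -> a (nth i0 l p) p.+1 <= b) ->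
  u S <= 4 * b * harmonic_sum (size l).
Proof.
move=> ul lS /andP[s0 sk] b0 hb.
set s := size l in s0 sk hb *; set H := harmonic_sum s.
have H0 : 0 <= H by apply: sumr_ge0 => j _; rewrite invr_ge0.
have sn : (s <= n)%N := leq_trans sk kn.
have [i0 _] : exists i0 : 'I_n, true by move: s0; rewrite /s; case: (l) => // i0; exists i0.
pose it p := nth i0 l p.
have Sk : (#|S| <= k)%N by rewrite -(eq_card lS) (card_uniqP ul).
have mean_le_sum w (e : R) : 0 < e ->
   ((G (restrict_coords S (fun i => X i w)))%:E + (\sum_(p < s) 2 * a (it p) p)%:E <=
    (2 * (b + e) * H + s%:R * e)%:E +
    \sum_(p < s) (2%:E * mean_then (it p) p (X (it p) w)))%E.
  move=> e0.
  have mean0 p : (0 <= mean_then (it p) p (X (it p) w))%E.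
    apply: integral_ge0 => w' _; rewrite lee_fin; apply: (value_ge0 g_ge0) => c.
    exact: copies_then_ge0.
  have [fin|] := pselect (forall p, (p < s)%N -> (mean_then (it p) p (X (it p) w) < +oo)%E); last first.
    (* An infinite conditional mean makes the right-hand side infinite. *)
    move=> /existsNP[p /not_implyP[ps /negP]]; rewrite -leNgt leye_eq => /eqP pinf.
    have -> : (\sum_(q < s) (2%:E * mean_then (it q) q (X (it q) w)) = +oo)%E.
      apply/eqP; rewrite esum_eqy; last by move=> q _; rewrite gt_eqF// (lt_le_trans (ltNyr 0))// mule_ge0.
      apply/existsP; exists (Ordinal ps); apply/eqP.
      by apply: etrans (congr1 (mule 2%:E) pinf) _; rewrite gt0_muley// lte_fin.
    by rewrite addey// leey.
  have ex p : exists w', (p < s)%N ->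
      G (restrict_coords (lt_set p) (fun c => Y (it p) c w')) <= 2 * (b + e) /\
      G (copies_then (it p) p w' (X (it p) w)) -
      G (restrict_coords (lt_set p) (fun c => Y (it p) c w')) <=
      2 * (fine (mean_then (it p) p (X (it p) w)) - a (it p) p) + e.
    have [ps|_] := ltnP p s; last by exists point.
    (* The threshold uses b + e because b may be 0, while [exists_low_sample] needs a positive
       bound. *)
    have [||||w' hw'] := @exists_low_sample (it p) p (X (it p) w) (b + e) e (leq_trans ps sk) (X_ge0 _ _).
    - by lra.
    - by [].
    - by apply: le_trans (score_nd _ (leq_trans ps sk)) _; have := hb i0 p ps; rewrite -/(it p); lra.
    - exact: fin.
    - by exists w'.
  have {ex} [wf hwf] := choice ex.
  have := @value_le_harmonic_marginals _ _ _ g_ge0 g_sym g_nd g_sub (2 * (b + e))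
    [seq X i w | i <- l] (fun p => first_copies (it p) p (wf p)).
  rewrite size_map -/s s0 sn => /(_ isT) main.
  have xs0 : all (>= 0) [seq X i w | i <- l] by apply/allP => _ /mapP[i _ ->].
  have hys p : (p < s)%N -> [/\ size (first_copies (it p) p (wf p)) = p,
      all (>= 0) (first_copies (it p) p (wf p)) & g (pad n (first_copies (it p) p (wf p))) <= 2 * (b + e)].
    move=> ps; have pn : (p <= n)%N by rewrite ltnW// (leq_trans ps).
    split; [exact: size_first_copies|by apply/allP => _ /mapP[c _ ->]|].
    by rewrite pad_first_copies//; case: (hwf p ps).
  have {main xs0 hys} := main xs0 hys.
  rewrite -(value_restrict_seq g_sym (X_ge0^~ w) ul lS) => main.
  have -> : (\sum_(p < s) (2%:E * mean_then (it p) p (X (it p) w)))%E =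
            (\sum_(p < s) 2 * fine (mean_then (it p) p (X (it p) w)))%:E.
    rewrite -sumEFin; apply: eq_bigr => p _; rewrite EFinM fineK// ge0_fin_numE//.
    exact: fin.
  rewrite -!EFinD lee_fin.
  have : \sum_(p < s) (g (pad n (rcons (first_copies (it p) p (wf p)) (nth 0 [seq X i w | i <- l] p))) -
      g (pad n (first_copies (it p) p (wf p)))) <=
    \sum_(p < s) (2 * fine (mean_then (it p) p (X (it p) w)) - 2 * a (it p) p + e).
    apply: ler_sum => p _; have ps := ltn_ord p.
    rewrite (nth_map i0)// pad_rcons_first_copies; last exact: leq_trans sn.
    rewrite pad_first_copies; last by rewrite ltnW// (leq_trans ps).
    by have [_] := hwf p ps; rewrite -/(it p); lra.
  move=> hsum; rewrite [X in _ <= X]big_split /= [X in _ <= X + _]sumrB sumr_const card_ord -[e *+ s]mulr_natl in hsum.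
  move: main hsum; rewrite -/H; lra.
suff le_e (e : R) : 0 < e -> u S <= 4 * b * H + e * (2 * H + s%:R).
  apply/ler_addgt0Pr => e e0.
  have c0 : 0 < 2 * H + s%:R by rewrite ltr_wpDl ?mulr_ge0// ltr0n.
  by have := le_e (e / (2 * H + s%:R)) (divr_gt0 e0 c0); rewrite divfK// gt_eqF.
move=> e0.
have a0 i p : 0 <= a i p.
  apply: fine_ge0; rewrite replication_scoreE; apply: integral_ge0 => w _; rewrite lee_fin.
  by apply/(value_ge0 g_ge0)/restrict_coords_ge0.
have mean0 i p w : (0 <= mean_then i p (X i w))%E.
  apply: integral_ge0 => w' _; rewrite lee_fin; apply: (value_ge0 g_ge0) => c.
  exact: copies_then_ge0.
have mf (p : 'I_s) : measurable_fun setT (fun w => 2%:E * mean_then (it p) p (X (it p) w))%E.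
  by apply: measurable_funeM; exact: (measurable_mean_then (it p) (widen_ord sn p)).
have f0 (p : 'I_s) w : setT w -> (0 <= 2%:E * mean_then (it p) p (X (it p) w))%E.
  by move=> _; rewrite mule_ge0.
have mG : measurable_fun setT (fun w => (G (restrict_coords S (fun i => X i w)))%:E).
  exact/measurable_EFinP/measurable_item_value.
have G0 w : 0 <= G (restrict_coords S (fun i => X i w)).
  by apply/(value_ge0 g_ge0)/restrict_coords_ge0.
have K0 : 0 <= \sum_(p < s) 2 * a (it p) p by apply: sumr_ge0 => p _; rewrite mulr_ge0.
have C0 : 0 <= 2 * (b + e) * H + s%:R * e.
  by rewrite addr_ge0 ?mulr_ge0 ?addr_ge0// ltW.
have : (\int[P]_w ((G (restrict_coords S (fun i => X i w)))%:E + (\sum_(p < s) 2 * a (it p) p)%:E) <=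
  \int[P]_w ((2 * (b + e) * H + s%:R * e)%:E +
    \sum_(p < s) (2%:E * mean_then (it p) p (X (it p) w))))%E.
  apply: ge0_le_integral => //.
  - by move=> w _; rewrite -EFinD lee_fin addr_ge0.
  - exact: emeasurable_funD.
  - by apply: emeasurable_funD => //; apply: emeasurable_sum.
  - by move=> w _; apply: mean_le_sum.
rewrite ge0_integralD//; last by move=> w _; rewrite lee_fin.
rewrite ge0_integralD//; last 2 first.
- by move=> w _; apply: sume_ge0 => p _; apply: f0.
- exact: emeasurable_sum.
rewrite ge0_integral_sum// !probability_integral_cst -utilityE -(fineK (u_fin Sk)) -/(u S).
have -> : (\sum_(p < s) \int[P]_w (2%:E * mean_then (it p) p (X (it p) w)) =
    (\sum_(p < s) 2 * a (it p) p.+1)%:E)%E.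
  rewrite -sumEFin; apply: eq_bigr => p _.
  rewrite ge0_integralZl_EFin//; last exact: (measurable_mean_then (it p) (widen_ord sn p)).
  rewrite (mean_then_item (it p) (widen_ord sn p)) EFinM fineK//.
  by apply: score_fin; apply: leq_trans sk.
rewrite -!EFinD lee_fin.
(* Each increment is at most b / (p + 1). This contributes 2 b H, and the common bound 2 (b + e) on
   the samples contributes the other 2 b H. *)
have : \sum_(p < s) 2 * a (it p) p.+1 - \sum_(p < s) 2 * a (it p) p <= 2 * b * H.
  rewrite -sumrB /H /harmonic_sum mulr_sumr; apply: ler_sum => p _.
  have pk : (p < k)%N := leq_trans (ltn_ord p) sk.
  rewrite -mulrBr -mulrA ler_pM2l// ler_pdivlMr// mulrC.
  by apply: le_trans (score_marginal_le _ pk) _; apply: hb.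
lra.
Qed.

End ScoreBounds.

(** * The program *)

Section Runs.
Context {R : realType}.
Variable score : nat -> nat -> R.
Implicit Types (p q : program) (s : state R) (Post : state R -> Prop).

Definition runs p s t Post :=
  exists t' s', [/\ exec score p s t' s', (t' <= t)%N & Post s'].

Lemma runs_weaken p s t t' Post Post' : (t <= t')%N -> (forall s', Post s' -> Post' s') ->
  runs p s t Post -> runs p s t' Post'.
Proof.
by move=> tt' PP' [u [s' [es us Ps]]]; exists u, s'; split; [|exact: leq_trans tt'|exact: PP'].
Qed.

Lemma runs_seq p q s t u Mid Post : runs p s t Mid ->
  (forall s', Mid s' -> runs q s' u Post) -> runs (Seq p q) s (t + u) Post.
Proof.
move=> [t' [s' [ep tt' Ms']]] /(_ s' Ms')[u' [s'' [eq uu' Ps]]].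
by exists (t' + u')%N, s''; split; [exact: exec_seq ep eq|exact: leq_add|].
Qed.

(** The invariant is indexed by the loop counter, which makes termination and the number of
    iterations evident. *)
Lemma runs_while a p t (Inv : nat -> state R -> Prop) :
  (forall m s, Inv m s -> nmem s a = m) ->
  (forall m s, Inv m.+1 s -> runs p s t (Inv m)) ->
  forall m s, Inv m s -> runs (While a p) s (m * t.+1).+1 (Inv 0%N).
Proof.
move=> Inva step; elim=> [|m IH] s Is.
  by exists 1%N, s; split; [apply/exec_while0/Inva| |].
have [t' [s' [ep tt' /IH[u [s'' [ew uu' I0]]]]]] := step m s Is.
exists (t' + u).+1, s''; split=> //.
  by apply: exec_whileS ep ew; rewrite (Inva _ _ Is).
by rewrite mulSn; lia.
Qed.

Fixpoint loop_free p : bool :=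
  match p with
  | Seq p q | IfN _ p q | IfR _ _ p q => loop_free p && loop_free q
  | While _ _ => false
  | _ => true
  end.

Fixpoint cost p : nat :=
  match p with
  | Skip => 0
  | Instr _ => 1
  | Seq p q => cost p + cost q
  | IfN _ p q | IfR _ _ p q => (maxn (cost p) (cost q)).+1
  | While _ _ => 0
  end.

(** Loop-free code is verified by computation. The values of [cost] and [eval] at [While] are
    placeholders, excluded by [loop_free] in [runs_eval]. *)
Fixpoint eval p s : state R :=
  match p with
  | Instr i => exec_instr score i s
  | Seq p q => eval q (eval p s)
  | IfN a p q => if nmem s a != 0%N then eval p s else eval q s
  | IfR a b p q => if rmem s a <= rmem s b then eval p s else eval q s
  | _ => s
  end.

Lemma runs_eval p s Post : loop_free p -> Post (eval p s) -> runs p s (cost p) Post.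
Proof.
move=> lf Ps; suff [t et tc] : exists2 t, exec score p s t (eval p s) & (t <= cost p)%N.
  by exists t, (eval p s).
elim: p s lf {Ps} => [|i|p IHp q IHq|a p IHp q IHq|a b p IHp q IHq|//] s /=.
- by exists 0%N => //; exact: exec_skip.
- by exists 1%N => //; exact: exec_instr1.
- move=> /andP[/IHp hp /IHq hq]; have [t et tc] := hp s; have [u eu uc] := hq (eval p s).
  by exists (t + u)%N; [exact: exec_seq et eu|exact: leq_add].
- move=> /andP[/IHp hp /IHq hq]; have [t et tc] := hp s; have [u eu uc] := hq s.
  case: ifP => ha; [exists t.+1|exists u.+1]; rewrite ?ltnS ?leq_max ?tc ?uc ?orbT//;
    by apply: exec_ifN; rewrite ha.
- move=> /andP[/IHp hp /IHq hq]; have [t et tc] := hp s; have [u eu uc] := hq s.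
  case: ifP => ha; [exists t.+1|exists u.+1]; rewrite ?ltnS ?leq_max ?tc ?uc ?orbT//;
    by apply: exec_ifR; rewrite ha.
Qed.

Lemma eval_marks q (l : seq nat) s :
  exists2 s', eval (foldr (fun j p => Seq (IfN j.+2 (Instr (ROne (j + 10))) Skip) p) q l) s = eval q s' &
    nmem s' = nmem s /\ forall c, rmem s' c =
      if has (fun j => (c == j + 10)%N && (nmem s j.+2 != 0%N)) l then 1 else rmem s c.
Proof.
elim: l s => [|j l IH] s /=; first by exists s.
set s1 := (if _ then _ else _); have [s' -> [sN sR]] := IH s1.
have s1N : nmem s1 = nmem s by rewrite /s1; case: ifP.
exists s'; rewrite ?sN ?s1N//; split=> // c; rewrite sR s1N; case: has; rewrite ?orbT// orbF.
by rewrite /s1; case: ifP => hj; rewrite /= ?andbF// andbT /upd.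
Qed.

End Runs.

Definition block (l : seq instr) : program := foldr (fun i p => Seq (Instr i) p) Skip l.

(* Only the cells N[0] and N[1] are free at the start, so the first six bits of
   the characteristic vector are moved to real cells to free N[2], ..., N[7].
   After [save_bits] and [copy_loop], R[10 + i] is the bit of item i. *)
Definition save_bits : program :=
  foldr (fun j p => Seq (IfN j.+2 (Instr (ROne (j + 10))) Skip) p)
    (block [:: NConst 6 1; NConst 7 9; NConst 1 6; NSub 3 0 1; ROne 2]) (iota 0 6).

(** With counter m + 1 the item treated is m + 6: its bit is in N[m + 8] and goes to R[m + 16],
    whence the offsets 7 and 15. *)
Definition copy_body : program :=
  Seq (block [:: NConst 1 7; NAdd 4 3 1; NLoad 4 4; NConst 1 15; NAdd 1 3 1])
  (Seq (IfN 4 (Instr (RStore 1 2)) Skip) (Instr (NSub 3 3 6))).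

Definition count_init : program := block [:: NConst 2 0; NAdd 3 0 2].

Definition count_body : program :=
  Seq (block [:: NAdd 4 3 7; RLoad 1 4])
  (Seq (IfR 2 1 (block [:: NAdd 2 2 6; RAdd 7 7 2]) Skip) (Instr (NSub 3 3 6))).

Definition argmin_init : program := block [:: NConst 5 0; NAdd 3 0 5].

Definition argmin_update : program := block [:: RAdd 3 4 8; NAdd 5 1 6].

(** N[5] is one plus the index of the best item so far and 0 if there is none, so no infinite
    initial score is required. *)
Definition argmin_body : program :=
  Seq (block [:: NAdd 4 3 7; RLoad 1 4])
  (Seq (IfR 2 1
         (Seq (block [:: NSub 1 3 6; RScore 4 1 2])
              (IfN 5 (IfR 4 3 argmin_update Skip) argmin_update))
         Skip)
       (Instr (NSub 3 3 6))).

Definition remove_best : program :=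
  Seq (block [:: NAdd 4 5 7; RStore 4 8])
  (Seq (IfR 5 3 (Instr (RAdd 5 3 8)) Skip)
       (block [:: RDiv 4 2 7; RAdd 6 6 4; RSub 7 7 2; NSub 2 2 6])).

Definition peel_body : program := Seq argmin_init (Seq (While 3 argmin_body) remove_best).

(* For r = |S|, ..., 1 the remaining item with the smallest score for r
   replications is removed; R[5] is the largest of the scores of the removed
   items and R[6] the partial harmonic sum. *)
Definition sketch_program : program :=
  Seq save_bits (Seq (While 3 copy_body) (Seq count_init (Seq (While 3 count_body)
    (Seq (While 2 peel_body) (Instr (RMul 0 5 6)))))).

(** * Correctness and running time of the program *)

Section SketchProgram.
Context {R : realType} {n k : nat}.
Variables (a : 'I_n -> nat -> R) (S : {set 'I_n}).
Hypotheses (n0 : (0 < n)%N) (kn : (k <= n)%N) (Sk : (#|S| <= k)%N).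

Local Notation score := (score_table k a).
Local Notation input := (input_state R k S).
Implicit Types (s : state R) (L : {set 'I_n}).

Definition has_index L (i : nat) : bool := if insub i is Some j then j \in L else false.

Lemma has_indexE L (j : 'I_n) : has_index L j = (j \in L).
Proof. by rewrite /has_index valK. Qed.

Lemma has_index_ge L i : (n <= i)%N -> has_index L i = false.
Proof. by move=> ni; rewrite /has_index insubF// ltnNge ni. Qed.

(** The constants of the program. A loop counter c + 1 plus nine is the address of the bit of item
    c; adding R[8] = 0 copies a real. *)
Definition registers s := [/\ nmem s 0 = n, nmem s 6 = 1%N, nmem s 7 = 9%N,
  rmem s 2 = 1 & rmem s 8 = 0].

Definition bits s L := forall i, rmem s i.+4.+4.+2 = (has_index L i)%:R.

Lemma nmem_input i : nmem input i.+2 = has_index S i.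
Proof. by rewrite /has_index /=; case: insub. Qed.

(** Items below 6 were saved at the start and those from m + 6 on have been copied; the remaining
    real cells are still 0. *)
Definition copy_inv m s := [/\ registers s, nmem s 3 = m,
  (forall i, nmem s i.+4.+4 = has_index S i.+4.+2),
  [/\ rmem s 5 = 0, rmem s 6 = 0 & rmem s 7 = 0] &
  forall i, rmem s i.+4.+4.+2 = ((has_index S i) && ((i < 6)%N || (m + 6 <= i)%N))%:R].

Lemma save_bitsP : runs score save_bits input (cost save_bits) (copy_inv (n - 6)).
Proof.
apply: runs_eval => //; rewrite /save_bits.
have [s1 -> [sN sR]] := eval_marks score
  (block [:: NConst 6 1; NConst 7 9; NConst 1 6; NSub 3 0 1; ROne 2]) (iota 0 6) input.
rewrite /= /setN /setR /upd /= sN.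
split.
- by split; rewrite /= ?sR.
- by [].
- by move=> i; rewrite /= -nmem_input.
- by split; rewrite /= sR.
- move=> i; rewrite /= sR; case: hasP => [[j]|nj].
    rewrite mem_iota add0n => /andP[_ j6] /andP[/eqP ij]; rewrite nmem_input.
    have -> : i = j by lia.
    by case: has_index => // _; rewrite j6.
  case: (boolP (has_index S i)) => //= Si; have [i6|i6] := ltnP i 6.
    by case: nj; exists i; rewrite ?mem_iota// nmem_input Si addnC eqxx.
  have [ni|ni] := leqP n i; first by rewrite has_index_ge in Si.
  by rewrite [(_ <= _)%N](_ : _ = false)//; apply/negbTE; rewrite -ltnNge; lia.
Qed.

Lemma copyP s : copy_inv (n - 6) s ->
  runs score (While 3 copy_body) s ((n - 6) * (cost copy_body).+1).+1 (copy_inv 0).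
Proof.
apply: runs_while => [m s' []//|m {}s [[s0 s6 s7 r2 r8] s3 sN [r5 r6 r7] sR]].
apply: runs_eval => //=; rewrite /exec_instr /setN /setR /= /upd /= s3.
have -> : (m.+1 + 7 = m.+4.+4)%N by lia.
have -> : (m.+1 + 15 = (m + 6).+4.+4.+2)%N by lia.
rewrite /= sN.
have hi6 : has_index S m.+4.+2 = has_index S (m + 6) by congr has_index; lia.
have sub1 : (m.+1 - nmem s 6 = m)%N by rewrite s6 subn1.
case: ifPn; rewrite eqb0 ?negbK hi6 => hm; split.
- by split.
- by rewrite /= s3.
- by move=> i; rewrite /= sN.
- by split.
- move=> i; rewrite /= r2 sR; case: eqVneq => [[->]|im]; first by rewrite hm leqnn orbT.
  have {}im : i <> (m + 6)%N by move=> e; rewrite e eqxx in im.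
  by congr (_ && _)%:R; congr (_ || _); apply/idP/idP; lia.
- by split.
- by rewrite /= s3.
- by move=> i; rewrite /= sN.
- by split.
- move=> i; rewrite /= sR; have [->|im] := eqVneq i (m + 6)%N; first by rewrite (negPf hm).
  by congr (_ && _)%:R; congr (_ || _); rewrite addSn ltn_neqAle eq_sym im.
Qed.

Definition count_inv m s := [/\ registers s, nmem s 3 = m, bits s S,
  nmem s 2 = #|[set j in S | (m <= j)%N]| /\ rmem s 7 = (nmem s 2)%:R &
  (m <= n)%N /\ (rmem s 5 = 0 /\ rmem s 6 = 0)].

Lemma count_initP s : copy_inv 0 s -> runs score count_init s (cost count_init) (count_inv n).
Proof.
move=> [[s0 s6 s7 r2 r8] s3 sN [r5 r6 r7] sR]; apply: runs_eval => //=.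
have card0 : #|[set j in S | (n <= j)%N]| = 0%N.
  by apply/eqP; rewrite cards_eq0; apply/eqP/setP => j; rewrite !inE leqNgt ltn_ord andbF.
rewrite /setN /setR /upd.
split.
- by split.
- by rewrite /= addn0.
- move=> i; rewrite /= sR; congr (_%:R); by rewrite add0n [(6 <= i)%N]leqNgt orbN andbT.
- by rewrite /= card0 r7.
- by split.
Qed.

Lemma countP s : count_inv n s ->
  runs score (While 3 count_body) s (n * (cost count_body).+1).+1 (count_inv 0).
Proof.
apply: runs_while => [m s' []//|m {}s [[s0 s6 s7 r2 r8] s3 sR [s2 r7] [mn [r5 r6]]]].
apply: runs_eval => //=; rewrite /exec_instr /setN /setR /= /upd /= s3 s7.
have -> : (m.+1 + 9 = m.+4.+4.+2)%N by lia.
rewrite r2 sR -[m in has_index _ m]/(val (Ordinal mn)) has_indexE.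
have split_card : #|[set j in S | (m <= j)%N]| =
    ((Ordinal mn \in S) + #|[set j in S | (m < j)%N]|)%N.
  rewrite (cardsD1 (Ordinal mn)) !inE leqnn andbT; congr (_ + _)%N.
  apply: eq_card => j; rewrite !inE [in RHS]ltn_neqAle -(inj_eq val_inj) /= [m == j]eq_sym.
  by case: (_ == _); rewrite /= ?andbF// andbT.
have sub1 : (m.+1 - nmem s 6 = m)%N by rewrite s6 subn1.
case: ifPn => hm; split.
- by split.
- by rewrite /= s3.
- by move=> i; rewrite /= sR.
- rewrite /= split_card s2 ?s6 r7 ?r2 s2 natrD; split=> //.
  by move: hm; case: (_ \in S); rewrite ?ler10// addnC.
- by split; [exact: ltnW|split].
- by split.
- by rewrite /= s3.
- by move=> i; rewrite /= sR.
- rewrite /= split_card s2 r7 s2.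
  by move: hm; case: (_ \in S); rewrite ?lexx.
- by split; [exact: ltnW|split].
Qed.

(** [L] is what remains and [l] lists the removed items, the latest first, so the item at position p
    was removed when r + p + 1 items remained. The set [L'] witnesses that [b] is a minimal score,
    as [min_score_le] requires. *)
Definition peel_inv r s := exists L l b,
  [/\ [/\ registers s, bits s L, nmem s 2 = r & rmem s 7 = r%:R],
      rmem s 5 = b /\ rmem s 6 = \sum_(r <= j < #|S|) j.+1%:R^-1,
      [/\ L \subset S, #|L| = r, uniq l & forall i, (i \in l) = (i \in S) && (i \notin L)],
      0 <= b /\ (forall i0 p, (p < size l)%N -> a (nth i0 l p) (r + p).+1 <= b) &
      b = 0 \/ exists L', [/\ (0 < #|L'|)%N, L' \subset S & forall j, j \in L' -> b <= a j #|L'|]].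

Lemma count_peel s : count_inv 0 s -> peel_inv #|S| s.
Proof.
move=> [rg s3 sR [s2 r7] [_ [r5 r6]]]; exists S, [::], 0.
have S0 : #|[set j in S | (0 <= j)%N]| = #|S|.
  by apply: eq_card => j; rewrite !inE andbT.
split=> //; try by left.
- by rewrite r7 s2 S0.
- by rewrite r5 r6 big_geq.
- by split=> // i; rewrite andbN.
Qed.

Definition argmin_inv L r (b h rho : R) c s :=
  [/\ [/\ registers s, bits s L, nmem s 2 = r & nmem s 3 = c],
      [/\ rmem s 5 = b, rmem s 6 = h & rmem s 7 = rho],
      (c <= n)%N &
      (nmem s 5 = 0%N /\ forall j : 'I_n, j \in L -> (j < c)%N) \/
      exists i : 'I_n, [/\ nmem s 5 = i.+1, i \in L, rmem s 3 = a i r &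
        forall j : 'I_n, j \in L -> (c <= j)%N -> rmem s 3 <= a j r]].

Lemma argminP L r b h rho s : (0 < r <= k)%N -> argmin_inv L r b h rho n s ->
  runs score (While 3 argmin_body) s (n * (cost argmin_body).+1).+1 (argmin_inv L r b h rho 0).
Proof.
move=> rk; apply: runs_while => [c s' [[]]//|c {}s].
move=> [[[s0 s6 s7 r2 r8] sR s2 s3] [r5 r6 r7] cn best].
apply: runs_eval => //=; rewrite /exec_instr /setN /setR /= /upd /= s3 s6 s7.
have -> : (c.+1 + 9 = c.+4.+4.+2)%N by lia.
pose i := Ordinal cn.
have scoreE : score c r = a i r.
  by rewrite /score_table -[c]/(val i) valK rk.
rewrite r2 sR -[c in has_index _ c]/(val i) has_indexE s2 ?subn1 /= scoreE.
have lt_cases (j : 'I_n) : (c <= j)%N -> j = i \/ (c < j)%N.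
  by rewrite leq_eqVlt => /orP[/eqP cj|]; [left; apply: val_inj|right].
have sub1 : (c.+1 - nmem s 6 = c)%N by rewrite s6 subn1.
have [iL|iL] := boolP (i \in L); rewrite ?lexx ?ler10 /=; last first.
  split; [by split => //=; rewrite s3|by split|exact: ltnW|].
  case: best => [[s5 lt]|[j [s5 jL r3 mn]]]; [left|right]; rewrite /=.
    split=> // j jL; have := lt j jL; rewrite ltnS => /[dup] jc; rewrite leq_eqVlt.
    by case/orP => // /eqP jci; case/negP: iL; rewrite (_ : i = j)//; apply: val_inj.
  exists j; split=> // j' j'L /lt_cases[j'i|cj']; last exact: mn.
  by case/negP: iL; rewrite -j'i.
case: ifPn => s5n0.
  case: best => [[s5]|[j [s5 jL r3 mn]]]; first by rewrite s5 in s5n0.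
  case: ifPn => le3.
    split; [by split => //=; rewrite s3|by split|exact: ltnW|right].
    exists i; rewrite /= r8 addr0 ?s6 addn1; split=> // j' j'L /lt_cases[->//|cj'].
    by apply: le_trans le3 _; exact: mn.
  split; [by split => //=; rewrite s3|by split|exact: ltnW|right].
  exists j; split=> // j' j'L /lt_cases[->|cj']; last exact: mn.
  by rewrite ltW// ltNge.
split; [by split => //=; rewrite s3|by split|exact: ltnW|right].
exists i; rewrite /= r8 addr0 ?s6 addn1; split=> // j' j'L /lt_cases[->//|cj'].
case: best => [[_ lt]|[j [s5 _ _ _]]]; last by rewrite s5 in s5n0.
by have := lt j' j'L; rewrite ltnS leqNgt cj'.
Qed.

Definition peel_cost := (cost argmin_init + ((n * (cost argmin_body).+1).+1 + cost remove_best))%N.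

Lemma peel_step r s : peel_inv r.+1 s -> runs score peel_body s peel_cost (peel_inv r).
Proof.
move=> [L [l [b [[[s0 s6 s7 r2 r8] sR s2 r7] [r5 r6] [LS cL ul lE] [b0 lb] hb]]]].
have rS : (r < #|S|)%N by rewrite -cL subset_leq_card.
have rk : (0 < r.+1 <= k)%N by rewrite /= (leq_trans rS).
apply: (@runs_seq _ _ _ _ _ _ _ (argmin_inv L r.+1 b (rmem s 6) (rmem s 7) n)).
  apply: runs_eval => //=; rewrite /setN /setR /upd; split; rewrite /= ?addn0//.
  by left; split=> // j _; apply: ltn_ord.
move=> {}s1 I1; apply: (runs_seq (argminP rk I1)).
move=> s' [[[s0' s6' s7' r2' r8'] sR' s2' s3'] [r5' r6' r7'] _ best].
case: best => [[_ Lemp]|[i [s5' iL r3' mn]]].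
  have [j jL] : exists j, j \in L by apply/set0Pn; rewrite -card_gt0 cL.
  by have := Lemp j jL.
apply: runs_eval => //=; rewrite /exec_instr /setN /setR /= /upd /= s5' s7'.
have -> : (i.+1 + 9 = i.+4.+4.+2)%N by lia.
pose b' := Num.max b (a i r.+1).
have bits' f : (forall x, f x.+4.+4.+2 = if x.+4.+4.+2 == i.+4.+4.+2 :> nat then 0 else rmem s' x.+4.+4.+2) ->
    forall x, f x.+4.+4.+2 = (has_index (L :\ i) x)%:R.
  move=> hf x; rewrite hf sR'; have [xn|xn] := ltnP x n; last first.
    by rewrite !has_index_ge//; case: ifP.
  rewrite -[x]/(val (Ordinal xn)) !has_indexE !inE -(inj_eq val_inj) /= !eqSS.
  by case: eqVneq.
have card' : #|L :\ i| = r by have := cardsD1 i L; rewrite iL cL => -[].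
have il : i \notin l by rewrite lE iL andbF.
have order' : uniq (i :: l) /\ forall j, (j \in i :: l) = (j \in S) && (j \notin L :\ i).
  split=> [|j]; first by rewrite /= il.
  rewrite !inE lE negb_and negbK andb_orr; have [->|_] := eqVneq j i; last by rewrite andbF.
  by rewrite (fintype.subsetP LS).
have lb' i0 p : (p < size (i :: l))%N -> a (nth i0 (i :: l) p) (r + p).+1 <= b'.
  case: p => [_|p] /=; first by rewrite addn0 le_max lexx orbT.
  by rewrite ltnS => /(lb i0); rewrite addSnnS le_max => ->.
have sum' : rmem s 6 + 1 / r.+1%:R = \sum_(r <= j < #|S|) j.+1%:R^-1.
  by rewrite r6 [RHS]big_ltn// addrC div1r.
(* If the new score becomes the maximum, [L] is the witness, since [i] has the smallest score in
   it. *)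
have hb' : b' = 0 \/ exists L', [/\ (0 < #|L'|)%N, L' \subset S & forall j, j \in L' -> b' <= a j #|L'|].
  rewrite /b'; case: leP => [_|_]; last exact: hb.
  right; exists L; rewrite cL; split=> // j0 j0L; rewrite -r3'; exact: mn.
have r7r : r.+1%:R - 1 = r%:R :> R by rewrite -natr1 addrK.
have LiS : L :\ i \subset S by apply: fintype.subset_trans LS; exact: subsetDl.
rewrite /= r5' r3' -/b'.
case: ifPn => ble; exists (L :\ i), (i :: l), b'; split.
- split=> /=; [by split|by apply: bits' => x /=; rewrite r8'|by rewrite s2' s6' subn1|].
  by rewrite r7' r7 r2' r7r.
- by rewrite /= ?r3' r8' addr0 /b' max_r// r6' r2' r7' r7 sum'.
- by case: order'; split.
- by split; rewrite // le_max b0.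
- exact: hb'.
- split=> /=; [by split|by apply: bits' => x /=; rewrite r8'|by rewrite s2' s6' subn1|].
  by rewrite r7' r7 r2' r7r.
- by rewrite /= r5' /b' max_l ?r6' ?r2' ?r7' ?r7 ?sum'// ltW// ltNge.
- by case: order'; split.
- by split; rewrite // le_max b0.
- exact: hb'.
Qed.

Lemma peelP s : peel_inv #|S| s ->
  runs score (While 2 peel_body) s (#|S| * peel_cost.+1).+1 (peel_inv 0).
Proof.
apply: runs_while; last exact: peel_step.
by move=> m s' [L [l [b [[]]]]].
Qed.


(** The output comes with two certificates: the order [l] serves the upper bound, and the set [L']
    the lower bound. *)
Lemma sketch_programP : exists2 y, computes_within sketch_program (200 * n ^ 2) k a S y &
  exists b l, [/\ y = b * harmonic_sum #|S|, 0 <= b, uniq l /\ l =i S,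
    (forall i0 p, (p < size l)%N -> a (nth i0 l p) p.+1 <= b) &
    b = 0 \/ exists L', [/\ (0 < #|L'|)%N, L' \subset S & forall j, j \in L' -> b <= a j #|L'|]].
Proof.
suff [t' [s' [es tt' [b [l h]]]]] : runs score sketch_program input (200 * n ^ 2)
    (fun s => exists b l, [/\ rmem s 0 = b * harmonic_sum #|S|, 0 <= b, uniq l /\ l =i S,
    (forall i0 p, (p < size l)%N -> a (nth i0 l p) p.+1 <= b) &
    b = 0 \/ exists L', [/\ (0 < #|L'|)%N, L' \subset S & forall j, j \in L' -> b <= a j #|L'|]]).
  exists (rmem s' 0); last by exists b, l.
  by exists t', s'.
have Sn : (#|S| <= n)%N := leq_trans Sk kn.
(* Only the nested loop is quadratic, with leading term 11 n^2; the constant 200 leaves ample room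
   for n >= 1. *)
apply: (@runs_weaken _ _ _ _ (cost save_bits + (((n - 6) * (cost copy_body).+1).+1 +
  (cost count_init + ((n * (cost count_body).+1).+1 + ((#|S| * peel_cost.+1).+1 + 1)))))%N _ _ _ _ (fun _ h => h)).
  have -> : peel_cost = (11 + n * 11)%N 
    by rewrite /peel_cost -[cost argmin_init]/2%N -[cost argmin_body]/10%N -[cost remove_best]/8%N; lia.
  have nn : (n <= n * n)%N by rewrite leq_pmulr.
  have Snn : (#|S| * (12 + n * 11) <= n * (12 + n * 11))%N by rewrite leq_mul2r Sn orbT.
  rewrite -[cost save_bits]/17%N -[cost copy_body]/8%N -[cost count_init]/2%N -[cost count_body]/6%N.
  rewrite expnS expn1; move: Snn; rewrite mulnDr mulnA -addSn; lia.
apply: runs_seq save_bitsP _ => s1 h1; apply: runs_seq (copyP h1) _ => s2 h2.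
apply: runs_seq (count_initP h2) _ => s3 h3; apply: runs_seq (countP h3) _ => s4 h4.
apply: runs_seq (peelP (count_peel h4)) _ => s5.
move=> [L [l [b [_ [r5 r6] [LS cL ul lE] [b0 lb] hb]]]].
apply: runs_eval => //; exists b, l; split=> //.
- by rewrite /= /upd /= r5 r6 big_mkord.
- split=> // i; rewrite lE (_ : L = finset.set0) ?inE ?andbT//.
  by apply/eqP; rewrite -cards_eq0 cL.
Qed.

End SketchProgram.

(** * Comparison of harmonic sums with the logarithm, and the final bounds *)

Lemma harmonic_sum_le {R : realType} m : (0 < m)%N ->
  harmonic_sum m <= ln (m%:R) + 1 :> R.
Proof.
elim: m => [//|[|m] IH] _.
  by rewrite /harmonic_sum big_ord_recl big_ord0 ln1 add0r addr0 invr1.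
rewrite /harmonic_sum big_ord_recr /= -/(harmonic_sum m.+1).
apply: le_trans (lerD (IH isT) (lexx _)) _.
have m1 : 0 < m.+1%:R :> R by [].
have m2 : 0 < m.+2%:R :> R by [].
have E : m.+1%:R = m.+2%:R * (1 + - m.+2%:R^-1) :> R.
  by rewrite mulrDr mulr1 mulrN divff ?gt_eqF// -[m.+2%:R]natr1 addrK.
have lt1 : m.+2%:R^-1 < 1 :> R by rewrite invf_lt1// ltr1n.
have pos : 0 < 1 + - m.+2%:R^-1 :> R by rewrite subr_gt0.
have -> : ln (m.+1%:R : R) = ln m.+2%:R + ln (1 + - m.+2%:R^-1).
  by rewrite {1}E lnM ?posrE.
have : ln (1 + - m.+2%:R^-1) <= - m.+2%:R^-1 :> R by apply: le_ln1Dx; rewrite ltrN2.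
(* The inequality ln (1 + x) <= x at x = -1 / (m + 2) bounds the new term by the increase of the
   logarithm. *)
move: (ln (1 + _)) (m.+2%:R^-1) (ln _) => x c y; lra.
Qed.

Unset Implicit Arguments.

Theorem theorem3 (R : realType) :
  exists (prog : program) (c e : nat),
  forall (n k : nat) (g : n.-tuple R -> R)
    (d : measure_display) (T : measurableType d) (P : probability T R)
    (X : 'I_n -> {RV P >-> R})
    (d' : measure_display) (T' : measurableType d') (Q : probability T' R)
    (Y : 'I_n -> 'I_n -> {RV Q >-> R}),
  (1 <= k <= n)%N ->
  measurable_fun (@orthant R n) g ->
  nonneg_valued g -> symmetric_fun g -> nondecreasing_value g -> submodular g -> BSP g ->
  (forall i w, 0 <= X i w) ->
  mutually_independent X ->
  (* Y i j is the j-th copy of X i *)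
  (forall i j w, 0 <= Y i j w) ->
  (forall i, mutually_independent (Y i)) ->
  (forall i j, same_distribution (X i) (Y i j)) ->
  (forall S : {set 'I_n}, (#|S| <= k)%N -> utility g X S \is a fin_num) ->
  (forall i r, (1 <= r <= k)%N -> replication_score g (Y i) r \is a fin_num) ->
  exists v : {set 'I_n} -> R,
    (* v(S) is computed in polynomial time from the replication test scores;
       for the empty set u is the constant g(0), on which the scores carry no
       information unless g is normalized *)
    (forall S : {set 'I_n}, (#|S| <= k)%N ->
       S != finset.set0 \/ g (pad n [::]) = 0 ->
       computes_within prog (c * n ^ e) k
         (fun i r => fine (replication_score g (Y i) r)) S (v S)) /\
    (forall S : {set 'I_n}, (#|S| <= k)%N ->
       ((1 / (2 * (ln (k%:R) + 1)) * v S)%:E <= utility g X S)%E /\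
       (utility g X S <= (6 * v S)%:E)%E).
Proof.
exists sketch_program, 200%N, 2%N.
move=> n k g d T P X d' T' Q Y /andP[k1 kn] g_meas g_ge0 g_sym g_nd g_sub _
  X0 Xind Y0 Yind XY u_fin a_fin.
have n1 : (0 < n)%N by apply: leq_trans kn.
pose a i r : R := fine (replication_score g (Y i) r).
have emptyE : utility g X finset.set0 = (g (pad n [::]))%:E.
  rewrite utilityE (eq_integral (fun=> (g (pad n [::]))%:E)) => [|w _].
    exact: probability_integral_cst.
  by congr _%:E; apply: value_ext => j; rewrite /restrict_coords inE nth_nil.
have pad0 : 0 <= g (pad n [::]).
  by apply: g_ge0; apply: orthant_mktuple => i; rewrite nth_nil.
have ex (S : {set 'I_n}) : exists v : R, (#|S| <= k)%N ->
    (S != finset.set0 \/ g (pad n [::]) = 0 ->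
       computes_within sketch_program (200 * n ^ 2) k a S v) /\
    (0 <= v /\ v <= 2 * (ln k%:R + 1) * fine (utility g X S) /\
     fine (utility g X S) <= 6 * v).
  have [Sk|_] := leqP #|S| k; last by exists 0.
  have lnk : 0 <= ln k%:R :> R by rewrite ln_ge0// ler1n.
  have [y cy [b [l [yE b0 [ul lS] lb hb]]]] := sketch_programP a n1 kn Sk.
  have [S0|S0] := eqVneq S finset.set0.
    (* On the empty set the program returns 0, while the value chosen is g(0); they agree when g(0)
       = 0. *)
    exists (g (pad n [::])) => _; rewrite S0 emptyE /=; split=> [[/eqP//|g0]|].
    - suff : y = 0 by rewrite g0 -S0 => <-.
      case: hb => [b00|[L' [L'0 L'S _]]]; first by rewrite yE b00 mul0r.
      by move: L'0; rewrite S0 finset.subset0 in L'S; rewrite (eqP L'S) cards0.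
    - by have := mulr_ge0 lnk pad0 => ?; split=> //; split; nra.
  exists y => _; split=> //.
  have sl : size l = #|S| by rewrite -(eq_card lS) (card_uniqP ul).
  have Spos : (0 < #|S|)%N by rewrite card_gt0.
  have H0 : 0 <= harmonic_sum #|S| :> R by apply: sumr_ge0 => j _; rewrite invr_ge0.
  have Hk : harmonic_sum #|S| <= ln k%:R + 1 :> R.
    apply: le_trans (harmonic_sum_le Spos) _; rewrite lerD2r ler_ln ?posrE ?ltr0n ?ler_nat//.
  have u0 : 0 <= fine (utility g X S).
    apply: fine_ge0; rewrite utilityE; apply: integral_ge0 => w _; rewrite lee_fin.
    by apply/(value_ge0 g_ge0)/restrict_coords_ge0.
  have y0 : 0 <= y by rewrite yE mulr_ge0.
  (* The construction yields the factor 4, which is weakened to 6 at the end. *)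
  have up : fine (utility g X S) <= 4 * y.
    have l0 : (0 < size l <= k)%N by rewrite sl Spos.
    have := utility_le_harmonic kn g_meas g_ge0 g_sym g_nd g_sub X0 Y0 Yind XY u_fin a_fin
      ul lS l0 b0 lb.
    by rewrite sl yE mulrA.
  have bu : b <= 2 * fine (utility g X S).
    case: hb => [->|[L' [L'0 L'S hL']]]; first by rewrite mulr_ge0.
    exact: (min_score_le g_meas g_ge0 g_sym g_nd g_sub X0 Xind Y0 Yind XY u_fin a_fin L'0 Sk L'S hL').
  split=> //; split; last lra.
  rewrite yE; apply: le_trans (ler_wpM2r H0 bu) _.
  by have := ler_wpM2l u0 Hk; lra.
have {ex} [v hv] := choice ex.
exists v; split=> S Sk; first by have [] := hv S Sk.
have [_ [v0 [vlow vup]]] := hv S Sk.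
have lnk : 0 <= ln k%:R :> R by rewrite ln_ge0// ler1n.
rewrite -(fineK (u_fin S Sk)) !lee_fin; split=> //.
by rewrite mul1r mulrC ler_pdivrMr 1?mulrC//; lra.
Qed.
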